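(* Let $\{t_n\}_{n\in\mathbb{Z}}$ be complex numbers with $t_n=\overline{t_{-n}}$ for all $n\in\mathbb{Z}$, and let the quadratic form $$t[g,g]=\sum_{n,m\ge 0} t_{n-m}\,g_m\,\overline{g_n}$$ be defined for $g\in\mathcal{D}$, where $\mathcal{D}\subset\ell^2(\mathbb{Z}_+)$ is the set of sequences with only finitely many non-zero components. Suppose that for some $\gamma\in\mathbb{R}$ $$t[g,g]\ge\gamma\|g\|^2_{\ell^2(\mathbb{Z}_+)}\quad\text{for all } g\in\mathcal{D}.$$ Let $M$ be the unique finite real Borel measure on the unit circle $\mathbb{T}$ such that $$t_n=\int_{\mathbb{T}} z^{-n}\,dM(z)\quad\text{for all } n\in\mathbb{Z}.$$ Then the form $t[g,g]$ (defined on $\mathcal{D}$) is closable in the space $\ell^2(\mathbb{Z}_+)$ if and only if the measure $M$ is absolutely continuous with respect to the normalized Lebesgue measure $\mathbf{m}$ on $\mathbb{T}$.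
   Context: $\mathbb{Z}_+=\{0,1,2,\ldots\}$; $\mathbf{m}$ is the Lebesgue measure on the unit circle $\mathbb{T}=\{z\in\mathbb{C}:|z|=1\}$ normalized by $\mathbf{m}(\mathbb{T})=1$. Under the hypotheses on $t_n$, a finite real Borel measure $M$ with $t_n=\int_{\mathbb{T}}z^{-n}dM(z)$ for all $n\in\mathbb{Z}$ exists and is unique, and it satisfies $M(X)\ge\gamma\,\mathbf{m}(X)$ for all Borel sets $X\subset\mathbb{T}$ (a consequence of the F. Riesz–Herglotz theorem). Closability: let $t[g,g]$ be a quadratic form defined on a dense linear subset $\mathcal{D}$ of a Hilbert space $\mathcal{H}$ with $t[g,g]\ge\gamma\|g\|^2$. Choose $\delta\in\mathbb{R}$ with $\gamma+\delta\geq 1$ and put $\|g\|_T=\sqrt{t[g,g]+\delta\|g\|^2}$. The form is called closable in $\mathcal{H}$ if for every sequence $g^{(k)}\in\mathcal{D}$ the conditions $\|g^{(k)}\|\to0$ as $k\to\infty$ and $\|g^{(k)}-g^{(l)}\|_T\to0$ as $k,l\to\infty$ imply $\|g^{(k)}\|_T\to0$. This does not depend on the choice of $\delta$. *)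

(* Defs.v *)
From HB Require Import structures.
From mathcomp Require Import all_boot all_order all_algebra.
From mathcomp Require Import all_classical all_reals all_analysis.
From mathcomp Require Import measurable_realfun complex.

Set Implicit Arguments.
Unset Strict Implicit.
Unset Printing Implicit Defensive.

Import Order.TTheory GRing.Theory Num.Theory.
Import numFieldNormedType.Exports.
Import ComplexField.

Local Open Scope classical_set_scope.
Local Open Scope ring_scope.
Local Open Scope complex_scope.

Section unit_circle.
Variable R : realType.

(* [R[i]^o] rather than [R[i]]: only the former carries the norm topology. *)
Definition unit_circle : set R[i]^o := [set z | `|z| = 1].

Definition circle : Type := set_type unit_circle.

HB.instance Definition _ := Topological.on circle.

Lemma unit_circle1 : (1 : R[i]^o) \in unit_circle.
Proof. by apply/mem_set; rewrite /unit_circle /= normr1. Qed.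

HB.instance Definition _ := 
  isPointed.Build circle (exist (fun z => z \in unit_circle) _ unit_circle1).

(* The Borel sigma-algebra: generated by the open sets of the subspace
   topology. *)
HB.instance Definition _ :=
  Measurable.copy circle (g_sigma_algebraType (@open circle)).

Definition circle_val (z : circle) : R[i] := set_val z.

Lemma unit_circle_expi (x : R) : (cos x +i* sin x : R[i]^o) \in unit_circle.
Proof.
apply/mem_set; rewrite /unit_circle /= normc_def /=.
by rewrite cos2Dsin2 sqrtr1.
Qed.

Definition expi (x : R) : circle :=
  exist (fun z => z \in unit_circle) _ (unit_circle_expi x).

Lemma continuous_expi : continuous (fun x : R => cos x +i* sin x : R[i]^o).
Proof.
move=> x; apply/cvgrPdist_lt => /= e.
case: e => a b; rewrite ltcE /= => /andP[/eqP -> a0].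
have a2 : 0 < a / 2 by rewrite divr_gt0.
near=> y.
have hc : `|cos x - cos y| < a / 2.
  by near: y; have /cvgrPdist_lt := @continuous_cos R x; exact.
have hs : `|sin x - sin y| < a / 2.
  by near: y; have /cvgrPdist_lt := @continuous_sin R x; exact.
rewrite (_ : _ - _ = (cos x - cos y) +i* (sin x - sin y)); last first.
  by apply/eqP; rewrite eq_complex /= !eqxx.
rewrite normc_def /= ltcR.
apply: (@le_lt_trans _ _ (`|cos x - cos y| + `|sin x - sin y|)); last first.
  by rewrite [ltRHS]splitr ltrD.
rewrite -[leRHS]ger0_norm ?addr_ge0// -sqrtr_sqr ler_wsqrtr//.
rewrite -(real_normK (num_real (cos x - cos y))).
rewrite -(real_normK (num_real (sin x - sin y))) sqrrD lerD2r lerDl.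
by rewrite mulrn_wge0// mulr_ge0.
Unshelve. all: by end_near. Qed.

Lemma measurable_expi : measurable_fun [set: R] expi.
Proof.
apply: (measurability (@open circle)) => //.
move=> _ [_ [U oU <-] <-]; rewrite setTI.
apply: open_measurable.
have -> : expi @^-1` (set_val @^-1` U) =
  (fun x : R => cos x +i* sin x : R[i]^o) @^-1` U by [].
by apply: open_comp => // x _; exact: continuous_expi.
Qed.

Definition circle_param (x : R) : circle := expi (2 * pi * x).

Lemma measurable_circle_param : measurable_fun [set: R] circle_param.
Proof.
apply: measurableT_comp; first exact: measurable_expi.
by apply: measurable_funM.
Qed.

(* Normalized Lebesgue measure: image of Lebesgue measure on [0, 1) under
   x |-> exp(2 i pi x). *)
Definition circle_measure : set circle -> \bar R :=
  pushforward (mrestr lebesgue_measure (measurable_itv `[0%R, 1%R[))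
    circle_param.

HB.instance Definition _ :=
  Measure.copy circle_measure
    (measure_function_pushforward__canonical__measure_function_Measure
       (mrestr lebesgue_measure (measurable_itv `[0%R, 1%R[))
       measurable_circle_param).

Lemma circle_measure_setT : circle_measure setT = 1%E.
Proof.
rewrite /circle_measure /pushforward preimage_setT /mrestr setTI.
by rewrite lebesgue_measure_itv /= lte_fin ltr01 sube0.
Qed.

End unit_circle.

Section charge_integral.
Local Open Scope ereal_scope.
Context d (T : measurableType d) (R : realType).
Variable nu : {charge set T -> \bar R}.

Lemma hahn_pair_subproof :
  {PN : set T * set T | hahn_decomposition nu PN.1 PN.2}.
Proof.
by apply: cid; have [P [N PN]] := Hahn_decomposition nu; exists (P, N).
Qed.

Definition hahn_pair := sval hahn_pair_subproof.

Definition hahn_pairP : hahn_decomposition nu hahn_pair.1 hahn_pair.2 :=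
  svalP hahn_pair_subproof.

(* The Jordan measures do not depend on the chosen Hahn decomposition:
   see [Hahn_decomposition_uniq]. *)
Definition charge_Rintegral (f : T -> R) : R :=
  (\int[jordan_pos hahn_pairP]_x f x - \int[jordan_neg hahn_pairP]_x f x)%R.

Definition charge_Cintegral (f : T -> R[i]) : R[i] :=
  charge_Rintegral (fun x => complex.Re (f x)) +i*
  charge_Rintegral (fun x => complex.Im (f x)).

End charge_integral.

Section closability.
Variables (R : realType) (V : zmodType).

(* [nrm] is the norm of the ambient space and [t] the diagonal [t[g, g]] of the
   form. *)
Definition form_norm (nrm t : V -> R) (delta : R) (g : V) : R :=
  Num.sqrt (t g + delta * nrm g ^+ 2).

Definition closable (nrm : V -> R) (D : set V) (t : V -> R) (delta : R) :=
  forall g : nat -> V, (forall k, D (g k)) ->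
    nrm (g k) @[k --> \oo] --> 0 ->
    form_norm nrm t delta (g kl.1 - g kl.2)
      @[kl --> filter_prod \oo \oo] --> 0 ->
    form_norm nrm t delta (g k) @[k --> \oo] --> 0.

End closability.

Section toeplitz.
Variable R : realType.

Definition l2norm (g : nat -> R[i]) : R :=
  Num.sqrt (limn (series (fun n => Normc.normc (g n) ^+ 2))).

Definition finitely_supported : set (nat -> R[i]) :=
  [set g | finite_set [set n | g n != 0]].

(* Sums with finite support, meaningful for [g] in [finitely_supported]. *)
Definition toeplitz_form (t : int -> R[i]) (g : nat -> R[i]) : R[i] :=
  \sum_(n \in [set: nat]) \sum_(m \in [set: nat])
    t (n%:Z - m%:Z) * g m * (g n)^*.

End toeplitz.

(* Main.v *)
From HB Require Import structures.
Require Import Defs.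
From mathcomp Require Import all_boot all_order all_algebra.
From mathcomp Require Import all_classical all_reals all_analysis.
From mathcomp Require Import complex measurable_realfun ring lra.

Import Order.TTheory GRing.Theory Num.Theory.
Import numFieldNormedType.Exports.
Set Implicit Arguments.
Unset Strict Implicit.
Unset Printing Implicit Defensive.

Local Open Scope classical_set_scope.
Local Open Scope ring_scope.
Local Open Scope complex_scope.

(* The form is [t[g, g] = \int |p|^2 dM] with [p(z) = \sum_n g_n z^n].

   Trigonometric polynomials are L2-dense for every finite Borel measure on the
   circle and each of them is unimodular times an analytic polynomial, so that
   semiboundedness turns [mu := M + delta m] into a measure with [m <= mu]. The
   norm [form_norm] is then the norm of [p] in [L2 mu], and [M << m] iff
   [mu << m].

   Let [Z] be the m-null carrier of the m-singular part of [mu]. Off [Z], up to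
   a set of small [mu]-measure, [mu] is bounded by a multiple of [m]. If
   [mu Z = 0], this forces the [L2 mu]-limit of a sequence tending to [0] in
   [L2 m] to vanish. In general, choose a trigonometric polynomial [q] close to
   the indicator of [Z] in [L2 mu], then [u = A q^2 = Re P] on the circle for
   an analytic polynomial [P] with [P(0) = \int u dm] small. The polynomial
   [(1 - P / n)^n], which behaves like [exp (- P)], is essentially bounded by
   [1], is small where [u] is large, that is on most of [Z], and has mean close
   to [1], hence is close to [1] in [L2 m]. Thus the indicator of [Z], which is
   [0] in [L2 m], lies in the closure of the analytic polynomials in [L2 mu],
   and closability forces [mu Z = 0]. *)

(** * Bounded measurable functions on a finite measure space *)

Section bounded_measurable.
Context d (T : measurableType d) (R : realType).
Implicit Types (f g : T -> R) (mu nu mup mun : {finite_measure set T -> \bar R}).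

(** This class is closed under the algebraic operations and integrable for every finite measure, so
    membership settles all integrability conditions for several measures at once. *)
Definition bdd_mfun f :=
  measurable_fun [set: T] f /\ exists B, forall x, `|f x| <= B.

Lemma bdd_mfun_cst (c : R) : bdd_mfun (fun=> c).
Proof. by split => //; exists `|c|. Qed.

Lemma bdd_mfunD f g : bdd_mfun f -> bdd_mfun g -> bdd_mfun (fun x => f x + g x).
Proof.
move=> [mf [B fB]] [mg [C gC]]; split; first exact: measurable_funD.
by exists (B + C) => x; rewrite (le_trans (ler_normD _ _))// lerD.
Qed.

Lemma bdd_mfunM f g : bdd_mfun f -> bdd_mfun g -> bdd_mfun (fun x => f x * g x).
Proof.
move=> [mf [B fB]] [mg [C gC]]; split; first exact: measurable_funM.
by exists (B * C) => x; rewrite normrM ler_pM.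
Qed.

Lemma bdd_mfunZ (c : R) f : bdd_mfun f -> bdd_mfun (fun x => c * f x).
Proof. by move=> bf; apply: bdd_mfunM => //; exact: bdd_mfun_cst. Qed.

Lemma bdd_mfunN f : bdd_mfun f -> bdd_mfun (fun x => - f x).
Proof.
by move=> [mf [B fB]]; split; [exact: measurable_funN|exists B => x;
  rewrite normrN].
Qed.

Lemma bdd_mfunB f g : bdd_mfun f -> bdd_mfun g -> bdd_mfun (fun x => f x - g x).
Proof. by move=> bf bg; apply: bdd_mfunD => //; exact: bdd_mfunN. Qed.

Lemma bdd_mfunX f n : bdd_mfun f -> bdd_mfun (fun x => f x ^+ n).
Proof.
move=> [mf [B fB]]; split; first exact: measurable_funX.
by exists (B ^+ n) => x; rewrite normrX lerXn2r// nnegrE// (le_trans _ (fB x)).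
Qed.

Lemma bdd_mfun_indic (A : set T) : measurable A -> bdd_mfun \1_A.
Proof.
move=> mA; split; first exact: measurable_indic.
by exists 1 => x; rewrite indicE; case: (_ \in _); rewrite ?normr1 ?normr0.
Qed.

Lemma bdd_mfun_integrable mu f : bdd_mfun f -> mu.-integrable setT (EFin \o f).
Proof.
move=> [mf [B fB]]; apply: measurable_bounded_integrable => //.
  by rewrite ltey_eq fin_num_measure.
by exists B; split; [exact: num_real|move=> C BC x _;
  exact: le_trans (fB x) (ltW BC)].
Qed.

Lemma EFin_Rintegral_bounded mu f : bdd_mfun f ->
  (\int[mu]_x (f x)%:E = (\int[mu]_x f x)%:E)%E.
Proof. by move=> bf; rewrite /Rintegral fineK// integrable_fin_num// bdd_mfun_integrable. Qed.

Lemma bdd_RintegralD mu f g : bdd_mfun f -> bdd_mfun g ->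
  \int[mu]_x (f x + g x) = \int[mu]_x f x + \int[mu]_x g x.
Proof. by move=> bf bg; rewrite RintegralD//; exact: bdd_mfun_integrable. Qed.

Lemma bdd_RintegralB mu f g : bdd_mfun f -> bdd_mfun g ->
  \int[mu]_x (f x - g x) = \int[mu]_x f x - \int[mu]_x g x.
Proof. by move=> bf bg; rewrite RintegralB//; exact: bdd_mfun_integrable. Qed.

Lemma bdd_RintegralZ mu (c : R) f : bdd_mfun f ->
  \int[mu]_x (c * f x) = c * \int[mu]_x f x.
Proof. by move=> bf; rewrite RintegralZl//; exact: bdd_mfun_integrable. Qed.

Lemma RintegralT_cst mu (c : R) : \int[mu]_x c = c * fine (mu setT).
Proof. by rewrite Rintegral_cst. Qed.

Lemma Rintegral_indic mu A : measurable A -> \int[mu]_x \1_A x = fine (mu A).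
Proof. by move=> mA; rewrite /Rintegral integral_indic// setIT. Qed.

Lemma RintegralT_ge0 mu f : (forall x, 0 <= f x) -> 0 <= \int[mu]_x f x.
Proof. by move=> f0; exact: Rintegral_ge0. Qed.

Lemma le_bdd_Rintegral mu f g : bdd_mfun f -> bdd_mfun g ->
  (forall x, f x <= g x) ->
  \int[mu]_x f x <= \int[mu]_x g x.
Proof. by move=> bf bg fg; apply: le_Rintegral => //;
  exact: bdd_mfun_integrable. Qed.

(** Dominated convergence with the constant [B] as dominating function, integrable because [mu] is
    finite. *)
Lemma bounded_convergence mu (f_ : nat -> T -> R) f B :
  (forall n, bdd_mfun (f_ n)) -> (forall n x, `|f_ n x| <= B) ->
  (forall x, f_ n x @[n --> \oo] --> f x) ->
  bdd_mfun f /\ \int[mu]_x f_ n x @[n --> \oo] --> \int[mu]_x f x.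
Proof.
move=> bf fB ff.
have mf : measurable_fun setT f.
  by apply: (measurable_fun_cvg (fun n => (bf n).1)) => x _; exact: ff.
have bmff : bdd_mfun f.
  split => //; exists B => x.
  by apply: (cvgr_to_le (cvg_norm (ff x))); apply: nearW => n; exact: fB.
split => //; apply: fine_cvg.
rewrite -EFin_Rintegral_bounded//.
have ffE x : (EFin \o f_ n) x @[n --> \oo] --> (EFin \o f) x.
  by apply: cvg_EFin; [exact: nearW|exact: ff].
have [_ _] := @dominated_convergence _ T R mu setT measurableT
  (fun n => EFin \o f_ n) (EFin \o f) (EFin \o cst B)
  (fun n => (measurable_EFinP _ _).2 (bf n).1) ((measurable_EFinP _ _).2 mf)
  (aeW _ (fun x _ => ffE x))
  (bdd_mfun_integrable mu (bdd_mfun_cst B)) (aeW _ (fun x n _ => fB n x)).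
exact.
Qed.

(** The restriction of [mu] to [E] lies setwise below [c nu], and the integral of a nonnegative
    function is monotone in the measure. *)
Lemma le_bdd_Rintegral_measure mu nu (E : set T) (c : R) f : measurable E ->
  0 <= c ->
  (forall A, measurable A -> A `<=` E -> fine (mu A) <= c * fine (nu A)) ->
  bdd_mfun f -> (forall x, 0 <= f x) ->
  \int[mu]_x (f x * \1_E x) <= c * \int[nu]_x f x.
Proof.
move=> mE c0 munu bf f0.
have mf : measurable_fun setT (EFin \o f) by apply/measurable_EFinP; exact: bf.1.
have bfE : bdd_mfun (fun x => f x * \1_E x) by apply: bdd_mfunM => //;
  exact: bdd_mfun_indic.
rewrite -lee_fin EFinM -!EFin_Rintegral_bounded//.
have -> : (\int[mu]_x (f x * \1_E x)%:E = \int[mrestr mu mE]_(x in E) (f x)%:E)%E.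
  rewrite -(@eq_measure_integral _ _ _ E (mrestr mu mE) mu); last first.
    by move=> A mA AE /=; rewrite /mrestr setIidl.
  rewrite [RHS]integral_mkcond; apply: eq_integral => x _ /=.
  by rewrite /patch indicE; case: (x \in E); rewrite ?mulr1 ?mulr0.
pose c' := NngNum c0.
have -> : (c%:E * \int[nu]_x (f x)%:E = \int[mscale c' nu]_x (f x)%:E)%E.
  by rewrite ge0_integral_mscale//= => x _; rewrite lee_fin.
apply: (@le_trans _ _ (\int[mscale c' nu]_(x in E) (f x)%:E)%E); last first.
  by apply: ge0_subset_integral => //= x _; rewrite lee_fin.
apply: ge0_le_measure_integral => //.
move=> A mA; rewrite /= /mrestr /mscale /=.
have mAE : measurable (A `&` E) by exact: measurableI.
have fin (la : {finite_measure set T ->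
  \bar R}) B (mB : measurable B) : la B = (fine (la B))%:E.
  by rewrite fineK// fin_num_measure.
rewrite (fin mu)// (fin nu A)// -EFinM lee_fin.
apply: (le_trans (munu _ mAE (@subIsetr _ _ _))); apply: ler_wpM2l => //.
by apply: fine_le; rewrite ?fin_num_measure// le_measure ?inE//; exact: subIsetl.
Qed.

(** Moving the negative terms to the other side turns the hypothesis into an equality between sums
    of positive measures, for which the integral is additive. *)
Lemma bdd_Rintegral_measure_lin mu mup mun nu (c : R) f :
  (forall A, measurable A ->
    fine (mu A) = fine (mup A) - fine (mun A) + c * fine (nu A)) ->
  bdd_mfun f -> (forall x, 0 <= f x) ->
  \int[mu]_x f x = \int[mup]_x f x - \int[mun]_x f x + c * \int[nu]_x f x.
Proof.
move=> muE bf f0.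
have mf : measurable_fun setT (EFin \o f) by apply/measurable_EFinP; exact: bf.1.
have f0' x : (0 <= (EFin \o f) x)%E by rewrite lee_fin.
(* The sign of [c] is free, so [c nu] is also split into two nonnegative multiples of [nu]. *)
have [c1 [c2 c12]] : exists c1 c2 : {nonneg R}, c = c1%:num - c2%:num.
  have [c0|c0] := leP 0 c; first by exists (NngNum c0), 0%:nng; rewrite /= subr0.
  have c0' : 0 <= - c by rewrite oppr_ge0 ltW.
  by exists 0%:nng, (NngNum c0'); rewrite /= sub0r opprK.
have sc (k : {nonneg R}) :
    (k%:num%:E * \int[nu]_x (f x)%:E = \int[mscale k nu]_x (f x)%:E)%E.
  by rewrite ge0_integral_mscale//= => x _; rewrite lee_fin.
have E : (\int[mu]_x (f x)%:E + \int[mun]_x (f x)%:E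
    + c2%:num%:E * \int[nu]_x (f x)%:E =
    \int[mup]_x (f x)%:E + c1%:num%:E * \int[nu]_x (f x)%:E)%E.
  rewrite !sc -!ge0_integral_measure_add//; try by move=> x _; rewrite lee_fin.
  apply: eq_measure_integral => A mA _.
  rewrite [LHS]measure_addE [X in (X + _)%E]measure_addE [RHS]measure_addE.
  have fin (la : {finite_measure set T -> \bar R}) : la A = (fine (la A))%:E.
    by rewrite fineK// fin_num_measure.
  change (mu A + mun A + c2%:num%:E * nu A = mup A + c1%:num%:E * nu A)%E.
  rewrite (fin mu) (fin mun) (fin mup) (fin nu) -!EFinM -!EFinD; congr EFin.
  by rewrite muE// c12; ring.
move: E; rewrite !EFin_Rintegral_bounded// -!EFinM -!EFinD => -[E].
by rewrite c12; lra.
Qed.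

End bounded_measurable.

(** * Trigonometric polynomials on the circle *)

Section complex_facts.
Variable R : rcfType.
Implicit Types x y : R[i].

Definition nsq x : R := complex.Re x ^+ 2 + complex.Im x ^+ 2.

Lemma ReD x y : complex.Re (x + y) = complex.Re x + complex.Re y.
Proof. by case: x; case: y. Qed.

Lemma ImD x y : complex.Im (x + y) = complex.Im x + complex.Im y.
Proof. by case: x; case: y. Qed.

Lemma ReN x : complex.Re (- x) = - complex.Re x.
Proof. by case: x. Qed.

Lemma ImN x : complex.Im (- x) = - complex.Im x.
Proof. by case: x. Qed.

Lemma ReM x y :
  complex.Re (x * y) = complex.Re x * complex.Re y - complex.Im x * complex.Im y.
Proof. by case: x; case: y. Qed.

Lemma ImM x y :
  complex.Im (x * y) = complex.Re x * complex.Im y + complex.Im x * complex.Re y.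
Proof. by case: x => a b; case: y => c d. Qed.

Lemma ReJ x : complex.Re x^* = complex.Re x.
Proof. by case: x. Qed.

Lemma ImJ x : complex.Im x^* = - complex.Im x.
Proof. by case: x. Qed.

Definition ReImE := (ReD, ImD, ReN, ImN, ReM, ImM, ReJ, ImJ).

Lemma complex_ext x y :
  complex.Re x = complex.Re y -> complex.Im x = complex.Im y -> x = y.
Proof. by case: x => a b; case: y => c d /= -> ->. Qed.

Lemma nsq_ge0 x : 0 <= nsq x.
Proof. by rewrite addr_ge0// sqr_ge0. Qed.

Lemma nsqM x y : nsq (x * y) = nsq x * nsq y.
Proof. by rewrite /nsq !ReImE; ring. Qed.

Lemma nsqX x n : nsq (x ^+ n) = nsq x ^+ n.
Proof.
elim: n => [|n ih]; last by rewrite !exprS nsqM ih.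
by rewrite !expr0 /nsq /= expr1n expr0n addr0.
Qed.

Lemma mul_conjc x : x * x^* = (nsq x)%:C.
Proof. by apply: complex_ext; rewrite !ReImE /nsq /=; ring. Qed.

Lemma nsq_normc x : Normc.normc x ^+ 2 = nsq x.
Proof. by case: x => a b; rewrite /= sqr_sqrtr// addr_ge0// sqr_ge0. Qed.

Lemma nsqD_le x y : nsq (x + y) <= 2 * nsq x + 2 * nsq y.
Proof.
rewrite /nsq !ReImE.
have := sqr_ge0 (complex.Re x - complex.Re y).
have := sqr_ge0 (complex.Im x - complex.Im y).
by nra.
Qed.

Lemma nsqN x : nsq (- x) = nsq x.
Proof. by rewrite /nsq !ReImE; ring. Qed.

Lemma nsqB_le x y : nsq (x - y) <= 2 * nsq x + 2 * nsq y.
Proof. by rewrite -(nsqN y) nsqD_le. Qed.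

End complex_facts.

(** * Real trigonometric polynomials as real parts of analytic ones *)

Section circle.
Variable R : realType.
Local Notation C := R[i].
Local Notation cv := (@circle_val R).
Implicit Types (p : {poly C}) (z : circle R) (q : circle R -> R).

Lemma nsq_circle z : nsq (cv z) = 1.
Proof.
case: z => w /= hw; have := set_mem hw; rewrite /unit_circle /= /circle_val.
rewrite set_valE /= normc_def => -[].
rewrite -/(nsq w) => h; rewrite -(sqr_sqrtr (nsq_ge0 w)) h expr1n //.
Qed.

Lemma circleJ z : cv z * (cv z)^* = 1.
Proof. by rewrite mul_conjc nsq_circle. Qed.

Lemma continuous_measurable_circle (f : circle R -> R) :
  continuous f -> measurable_fun setT f.
Proof.
move=> cf; apply: (measurability _ (RGenOpens.measurableE R)).
move=> _ [_ [x [y ->]] <-]; rewrite setTI; apply: sub_sigma_algebra.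
by apply: open_comp => //; exact: interval_open.
Qed.

Lemma continuous_circle_val : continuous (set_val : circle R -> C^o).
Proof. exact: initial_continuous. Qed.

Lemma continuous_Re : continuous (@complex.Re R : C^o -> R).
Proof.
move=> x; apply/(cvgrPdist_lt (FF := nbhs_filter x)) => e e0.
have /cvgrPdist_lt /(_ e%:C) := @cvg_id _ (nbhs x).
rewrite ltcR => /(_ e0); apply: (@filterS _ _ (nbhs_filter x)) => y.
rewrite normc_def ltcR; apply: le_lt_trans.
by rewrite -sqrtr_sqr -ReN -ReD ler_wsqrtr// lerDl sqr_ge0.
Qed.

Lemma continuous_Im : continuous (@complex.Im R : C^o -> R).
Proof.
move=> x; apply/(cvgrPdist_lt (FF := nbhs_filter x)) => e e0.
have /cvgrPdist_lt /(_ e%:C) := @cvg_id _ (nbhs x).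
rewrite ltcR => /(_ e0); apply: (@filterS _ _ (nbhs_filter x)) => y.
rewrite normc_def ltcR; apply: le_lt_trans.
by rewrite -sqrtr_sqr -ImN -ImD ler_wsqrtr// lerDr sqr_ge0.
Qed.

Lemma measurable_Re_circle : measurable_fun setT (fun z => complex.Re (cv z)).
Proof.
apply: continuous_measurable_circle => z.
by apply: continuous_comp; [exact: continuous_circle_val|exact: continuous_Re].
Qed.

Lemma measurable_Im_circle : measurable_fun setT (fun z => complex.Im (cv z)).
Proof.
apply: continuous_measurable_circle => z.
by apply: continuous_comp; [exact: continuous_circle_val|exact: continuous_Im].
Qed.

(** Both parts are treated in one induction because a Horner step mixes them; the coordinates of a
    point of the circle are bounded by 1. *)
Lemma bdd_mfun_Re_Im_horner p : bdd_mfun (fun z => complex.Re p.[cv z]) /\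
  bdd_mfun (fun z => complex.Im p.[cv z]).
Proof.
have cvb z : `|complex.Re (cv z)| <= 1 /\ `|complex.Im (cv z)| <= 1.
  have := nsq_circle z; rewrite /nsq => h.
  have := sqr_ge0 (complex.Re (cv z)); have := sqr_ge0 (complex.Im (cv z)) => h1 h2.
  by split; rewrite ler_norml; apply/andP; split; nra.
have bRe : bdd_mfun (fun z => complex.Re (cv z)).
  by split; [exact: measurable_Re_circle|exists 1 => z; have [] := cvb z].
have bIm : bdd_mfun (fun z => complex.Im (cv z)).
  by split; [exact: measurable_Im_circle|exists 1 => z; have [] := cvb z].
elim/poly_ind: p => [|p c [ihR ihI]].
  by split; under eq_fun do rewrite horner0; exact: bdd_mfun_cst.
split; under eq_fun do rewrite hornerMXaddC !ReImE.
  by apply: bdd_mfunD; [apply: bdd_mfunB; exact: bdd_mfunM|exact: bdd_mfun_cst].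
by apply: bdd_mfunD; [apply: bdd_mfunD; exact: bdd_mfunM|exact: bdd_mfun_cst].
Qed.

Definition bdd_mfun_Re p := (bdd_mfun_Re_Im_horner p).1.
Definition bdd_mfun_Im p := (bdd_mfun_Re_Im_horner p).2.

Lemma bdd_mfun_nsq p : bdd_mfun (fun z => nsq p.[cv z]).
Proof. by apply: bdd_mfunD; apply: bdd_mfunX;
  [exact: bdd_mfun_Re|exact: bdd_mfun_Im]. Qed.

(** Analytic polynomials suffice to describe all real trigonometric polynomials, because [z^-n] is
    the conjugate of [z^n] on the circle. *)
Definition trigpoly q := exists p, forall z, q z = complex.Re p.[cv z].

Lemma trigpoly_bdd_mfun q : trigpoly q -> bdd_mfun q.
Proof. by move=> [p /funext ->]; exact: bdd_mfun_Re. Qed.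

Lemma trigpoly_cst c : trigpoly (fun=> c).
Proof. by exists (c%:C)%:P => z; rewrite hornerC. Qed.

Lemma trigpolyD q1 q2 : trigpoly q1 -> trigpoly q2 ->
  trigpoly (fun z => q1 z + q2 z).
Proof.
by move=> [p1 h1] [p2 h2]; exists (p1 + p2) => z; rewrite hornerD ReD h1 h2.
Qed.

Lemma trigpoly_Re : trigpoly (fun z => complex.Re (cv z)).
Proof. by exists 'X => z; rewrite hornerX. Qed.

Lemma trigpoly_Im : trigpoly (fun z => complex.Im (cv z)).
Proof.
exists ((- 'i%C)%:P * 'X) => z; rewrite hornerM hornerC hornerX !ReImE /=; ring.
Qed.

(** Conjugation is inversion on the circle, so a high enough power of [z] clears the negative powers
    in the conjugate of [p]. *)
Lemma poly_conj_circle p : exists N p', forall z,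
  p'.[cv z] = cv z ^+ N * (p.[cv z])^*.
Proof.
elim/poly_ind: p => [|p c [N [p' ih]]].
  by exists 0%N, 0 => z; rewrite !horner0 rmorph0 mulr0.
exists N.+1, (p' + (c^*)%:P * 'X^(N.+1)) => z.
rewrite hornerMXaddC rmorphD rmorphM /= hornerD hornerM hornerC hornerXn ih.
have := circleJ z; set w := cv z => wJ.
by rewrite -[_ * (p.[w])^*]mulr1 -wJ exprSr; ring.
Qed.

(** One conjugate factor cancels one factor [z] of the nonconstant part of [p]; the constant term
    leaves a pure conjugate power, which has the same real part as its conjugate. The induction is
    on [N], and [poly_ind] only splits off the constant term. *)
Lemma Re_shift_trigpoly N p :
  trigpoly (fun z => complex.Re ((cv z)^* ^+ N * p.[cv z])).
Proof.
elim: N p => [|N ih] p; first by exists p => z; rewrite expr0 mul1r.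
elim/poly_ind: p => [|p c _].
  by exists 0 => z; rewrite !horner0 mulr0.
have [p' hp'] := ih p.
exists (p' + (c^*)%:P * 'X^(N.+1)) => z.
rewrite hornerMXaddC hornerD hornerM hornerC hornerXn mulrDr !ReD; congr (_ + _).
  rewrite -hp'; congr complex.Re.
  have := circleJ z; set w := cv z => wJ.
  by rewrite exprSr -mulrA (mulrCA _ p.[w]) (mulrC _ w) wJ mulr1.
by rewrite -ReJ rmorphM rmorphXn /= conjcK mulrC.
Qed.

Lemma trigpolyM q1 q2 : trigpoly q1 -> trigpoly q2 ->
  trigpoly (fun z => q1 z * q2 z).
Proof.
move=> [p1 h1] [p2 h2].
have [N [p2' h2']] := poly_conj_circle p2.
have [p3 h3] := Re_shift_trigpoly N (p1 * p2').
exists ((2^-1)%:C%:P * (p1 * p2 + p3)) => z.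
rewrite hornerM hornerC hornerD hornerM ReM ReD -h3 h1 h2 hornerM h2'.
have -> : (cv z)^* ^+ N * (p1.[cv z] * (cv z ^+ N * (p2.[cv z])^*)) =
    p1.[cv z] * (p2.[cv z])^*.
  rewrite mulrCA; congr (_ * _).
  by rewrite mulrA -exprMn (mulrC _ (cv z)) circleJ expr1n mul1r.
by rewrite !ReImE /=; field.
Qed.

Lemma trigpolyX q n : trigpoly q -> trigpoly (fun z => q z ^+ n).
Proof.
move=> tq; elim: n => [|n ih]; first exact: trigpoly_cst.
by under eq_fun do rewrite exprS; exact: trigpolyM.
Qed.

Lemma trigpolyZ c q : trigpoly q -> trigpoly (fun z => c * q z).
Proof. by move=> tq; apply: trigpolyM => //; exact: trigpoly_cst. Qed.

Lemma trigpolyB q1 q2 : trigpoly q1 -> trigpoly q2 ->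
  trigpoly (fun z => q1 z - q2 z).
Proof.
move=> t1 t2; apply: trigpolyD => //.
by under eq_fun do rewrite -mulN1r; exact: trigpolyZ.
Qed.

Lemma trigpoly_sqr q : trigpoly q -> exists p, forall z, q z ^+ 2 = nsq p.[cv z].
Proof.
move=> [p hp]; have [N [p' hp']] := poly_conj_circle p.
exists ((2^-1)%:C%:P * ('X^N * p + p')) => z.
rewrite hornerM hornerC hornerD hornerM hornerXn hp' -mulrDr !nsqM nsqX nsq_circle.
by rewrite expr1n mul1r hp /nsq !ReImE /=; field.
Qed.

End circle.

(** * Density of trigonometric polynomials *)

Section step.
Variable R : realType.

Lemma bernoulli (h : R) n : -1 <= h -> 1 + n%:R * h <= (1 + h) ^+ n.
Proof.
move=> h1; elim: n => [|n ih]; first by rewrite mul0r addr0 expr0.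
rewrite exprS; have h0 : 0 <= 1 + h by lra.
apply: le_trans (ler_wpM2l h0 ih); rewrite -natr1.
have : 0 <= n%:R * h ^+ 2 :> R by rewrite mulr_ge0// sqr_ge0.
by nra.
Qed.

(** With [y = (1 + x) / 2] one has [x <= y^2], so [n x^n <= (n y^n) y^n]; Bernoulli's inequality for
    [1 + h = 1 / y] bounds [n y^n] by [1 / h]. *)
Lemma cvg_natmul_geometric (x : R) : 0 <= x < 1 ->
  n%:R * x ^+ n @[n --> \oo] --> (0 : R).
Proof.
move=> /andP[x0 x1]; pose y := (1 + x) / 2; pose h := y^-1 - 1.
have y0 : 0 < y by rewrite /y; lra.
have y1 : y < 1 by rewrite /y; lra.
have xy : x <= y ^+ 2 by rewrite /y; have := sqr_ge0 (1 - x); nra.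
have h0 : 0 < h by rewrite /h subr_gt0 invf_gt1.
have yh : y * (1 + h) = 1 by rewrite /h addrC subrK mulfV ?gt_eqF.
have cy : h^-1 * y ^+ n @[n --> \oo] --> (0 : R).
  rewrite -(mulr0 h^-1); apply: cvgMr; apply: cvg_expr.
  by rewrite ger0_norm// ltW.
apply: (squeeze_cvgr _ (cvg_cst 0) cy); apply: nearW => n.
apply/andP; split; first by rewrite mulr_ge0// exprn_ge0.
have bern : n%:R * h * y ^+ n <= 1.
  have := @bernoulli h n; have hh : -1 <= h by lra.
  move=> /(_ hh) b.
  apply: (@le_trans _ _ ((1 + h) ^+ n * y ^+ n)).
    by rewrite ler_wpM2r ?exprn_ge0 ?(ltW y0)// (le_trans _ b)// lerDr ler01.
  by rewrite -exprMn mulrC yh expr1n.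
apply: (@le_trans _ _ (n%:R * (y ^+ n * y ^+ n))).
  rewrite ler_wpM2l// -expr2 -exprM mulnC exprM.
  by rewrite lerXn2r// nnegrE// sqr_ge0.
rewrite mulrA ler_wpM2r//; first exact/exprn_ge0/ltW.
rewrite -(@ler_pM2r _ h)// mulVf ?gt_eqF//.
by apply: le_trans bern; rewrite mulrAC.
Qed.

(* The polynomials of Brosowski and Deutsch's proof of the Stone-Weierstrass
   theorem; the factor [n] in the exponent makes the limit at [s = 1 / 2] equal
   to [0]. *)
Definition step_poly (n : nat) (s : R) : R := (1 - s ^+ n) ^+ (n * 2 ^ n).

Lemma step_poly_bound n (s : R) : 0 <= s <= 1 -> 0 <= step_poly n s <= 1.
Proof.
move=> /andP[s0 s1]; have t0 : 0 <= s ^+ n by rewrite exprn_ge0.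
have t1 : s ^+ n <= 1 by rewrite exprn_ile1.
by rewrite /step_poly exprn_ge0 ?exprn_ile1//; lra.
Qed.

(** Below [1 / 2], Bernoulli's inequality gives the lower bound [1 - n (2 s)^n]. From [1 / 2] on, it
    is applied to [1 + s^n] instead. *)
Lemma cvg_step_poly (s : R) : 0 <= s <= 1 ->
  step_poly n s @[n --> \oo] --> ((s < 1 / 2)%R%:R : R).
Proof.
move=> /andP[s0 s1].
have t0 n : 0 <= s ^+ n by rewrite exprn_ge0.
have t1 n : s ^+ n <= 1 by rewrite exprn_ile1.
have sb n : 0 <= step_poly n s <= 1 by apply: step_poly_bound; rewrite s0.
have nE n : (n * 2 ^ n)%:R * s ^+ n = n%:R * (2 * s) ^+ n :> R.
  by rewrite natrM natrX exprMn mulrA.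
have [s2|s2] := ltP s (1/2).
  have c : 1 - n%:R * (2 * s) ^+ n @[n --> \oo] --> (1 : R).
    rewrite -[X in _ --> X]subr0; apply: cvgB; first exact: cvg_cst.
    by apply: cvg_natmul_geometric; lra.
  rewrite /= mulr1n; apply: (squeeze_cvgr _ c (cvg_cst (1 : R))); apply: nearW => n.
  have /andP[_ ->] := sb n.
  rewrite andbT -nE; have := @bernoulli (- s ^+ n) (n * 2 ^ n).
  by rewrite mulrN; apply; have := t1 n; lra.
rewrite /= mulr0n; have c : (n%:R + 1)^-1 @[n --> \oo] --> (0 : R).
  by under eq_fun do rewrite natr1; exact: cvg_harmonic.
apply: (squeeze_cvgr _ (cvg_cst 0) c); apply: nearW => n.
have /andP[-> _] := sb n.
rewrite /= -[leRHS]mul1r ler_pdivlMr ?natr1//.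
(* Since [(1 - s^n) (1 + s^n) <= 1], this lower bound forces [step_poly n s <= 1 / (n + 1)]. *)
have ge1 : n%:R + 1 <= (1 + s ^+ n) ^+ (n * 2 ^ n).
  apply: le_trans (bernoulli _ _); last by have := t0 n; lra.
  rewrite nE addrC lerD2l ler_peMr// exprn_ege1//; lra.
apply: (@le_trans _ _ (step_poly n s * (1 + s ^+ n) ^+ (n * 2 ^ n))).
  by rewrite ler_wpM2l -?natr1//; have /andP[] := sb n.
rewrite /step_poly -exprMn exprn_ile1//.
  by rewrite mulr_ge0//; have := t0 n; have := t1 n; lra.
by have := t0 n; have := t1 n; nra.
Qed.

End step.

(** * Closure properties of L2-approximability *)

Section density.
Variables (R : realType) (la : {finite_measure set (circle R) -> \bar R}).
Local Notation C := R[i].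
Local Notation cv := (@circle_val R).
Implicit Types (f g q : circle R -> R) (z : circle R).

Definition approximable f := bdd_mfun f /\
  forall e, 0 < e -> exists2 q, trigpoly q & \int[la]_z (q z - f z) ^+ 2 < e.

Lemma approximable_trigpoly q : trigpoly q -> approximable q.
Proof.
move=> tq; split; [exact: trigpoly_bdd_mfun|move=> e e0; exists q => //].
by under eq_Rintegral do rewrite subrr expr0n/=; rewrite RintegralT_cst mul0r.
Qed.

(** From [(x + y)^2 <= 2 x^2 + 2 y^2], two squared errors below [e / 4] add up to less than [e]. *)
Lemma approximable_closure f : bdd_mfun f ->
  (forall e, 0 < e -> exists2 g, approximable g & \int[la]_z (g z - f z) ^+ 2 < e) ->
  approximable f.
Proof.
move=> bf H; split => // e e0; have e4 : 0 < e / 4 by lra.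
have [g [bg ag] gf] := H _ e4; have [q tq qg] := ag _ e4.
have bq := trigpoly_bdd_mfun tq.
exists q => //.
have b1 : bdd_mfun (fun z => (q z - g z) ^+ 2) by apply: bdd_mfunX;
  exact: bdd_mfunB.
have b2 : bdd_mfun (fun z => (g z - f z) ^+ 2) by apply: bdd_mfunX;
  exact: bdd_mfunB.
apply: (@le_lt_trans _ _ (\int[la]_z (2 * (q z - g z) ^+ 2
  + 2 * (g z - f z) ^+ 2))).
  apply: le_bdd_Rintegral; [by apply: bdd_mfunX;
    exact: bdd_mfunB|by apply: bdd_mfunD; exact: bdd_mfunZ|].
  move=> z; have := sqr_ge0 (q z - g z - (g z - f z)); nra.
by rewrite bdd_RintegralD ?bdd_RintegralZ//;
  [lra|exact: bdd_mfunZ|exact: bdd_mfunZ].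
Qed.

Lemma approximable_lim (f_ : nat -> circle R -> R) f B :
  (forall n, approximable (f_ n)) -> (forall n z, `|f_ n z| <= B) ->
  (forall z, f_ n z @[n --> \oo] --> f z) -> approximable f.
Proof.
move=> af fB ff.
have [bf _] := bounded_convergence la (fun n => (af n).1) fB ff.
have fB' z : `|f z| <= B.
  by apply: (cvgr_to_le (cvg_norm (ff z))); apply: nearW => n; exact: fB.
have cI := @bounded_convergence _ _ R la (fun n z => (f_ n z - f z) ^+ 2)
    (fun=> 0) ((B + B) ^+ 2).
apply: approximable_closure => // e e0.
have : \int[la]_x (f_ n x - f x) ^+ 2 @[n --> \oo] --> (0 : R).
  have -> : (0 : R) = \int[la]_(x in setT) 0 by rewrite RintegralT_cst mul0r.
  apply: (cI _ _ _).2.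
  - by move=> n; apply: bdd_mfunX; apply: bdd_mfunB => //; exact: (af n).1.
  - move=> n x; rewrite normrX lerXn2r ?nnegrE ?addr_ge0//.
    + exact: le_trans (normr_ge0 _) (fB' x).
    + exact: le_trans (normr_ge0 _) (fB' x).
    + by rewrite (le_trans (ler_normB _ _))// lerD.
  - move=> z; have -> : (0 : R) = (f z - f z) ^+ 2 by rewrite subrr expr0n.
    apply: (@cvg_comp _ _ _ (fun n => f_ n z - f z) (fun x => x ^+ 2)).
      by apply: cvgB; [exact: ff|exact: cvg_cst].
    exact: exprn_continuous.
move/cvgr_lt => /(_ e e0) [N _ /(_ N (leqnn N)) h].
by exists (f_ N).
Qed.

(** The factors are replaced one at a time. The other factor is bounded by some [B], so the squared
    error grows at most by [B^2]; [B^2 + 1] keeps the divisor positive. The case of a trigonometric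
    second factor comes last. *)
Lemma approximableM f g : approximable f -> approximable g ->
  approximable (fun z => f z * g z).
Proof.
suff H f' q : approximable f' -> trigpoly q -> approximable (fun z => f' z * q z).
  move=> af [bg ag]; have [bf _] := af; have [_ [B fB]] := bf.
  apply: approximable_closure; first exact: bdd_mfunM.
  move=> e e0; have B1 : 0 < B ^+ 2 + 1 by have := sqr_ge0 B; lra.
  have [|q tq qg] := ag (e / (B ^+ 2 + 1)); first by rewrite divr_gt0.
  exists (fun z => f z * q z); first exact: H.
  have bq := trigpoly_bdd_mfun tq.
  have b1 : bdd_mfun (fun z => (q z - g z) ^+ 2) by apply: bdd_mfunX;
    exact: bdd_mfunB.
  apply: (@le_lt_trans _ _ (\int[la]_z ((B ^+ 2 + 1) * (q z - g z) ^+ 2))).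
    apply: le_bdd_Rintegral; [|exact: bdd_mfunZ|].
      by apply: bdd_mfunX; apply: bdd_mfunB; exact: bdd_mfunM.
    move=> z; rewrite -mulrBr exprMn ler_wpM2r ?sqr_ge0//.
    rewrite -real_normK ?num_real// (@le_trans _ _ (B ^+ 2)) ?lerDl//.
    by rewrite lerXn2r ?nnegrE// (le_trans _ (fB z)).
  by rewrite bdd_RintegralZ// mulrC -ltr_pdivlMr.
move=> [bf af] tq; have bq := trigpoly_bdd_mfun tq; have [_ [B qB]] := bq.
apply: approximable_closure; first exact: bdd_mfunM.
move=> e e0; have B1 : 0 < B ^+ 2 + 1 by have := sqr_ge0 B; lra.
have [|q' tq' qf] := af (e / (B ^+ 2 + 1)); first by rewrite divr_gt0.
exists (fun z => q' z * q z); first exact/approximable_trigpoly/trigpolyM.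
have bq' := trigpoly_bdd_mfun tq'.
have b1 : bdd_mfun (fun z => (q' z - f' z) ^+ 2) by apply: bdd_mfunX;
  exact: bdd_mfunB.
apply: (@le_lt_trans _ _ (\int[la]_z ((B ^+ 2 + 1) * (q' z - f' z) ^+ 2))).
  apply: le_bdd_Rintegral; [|exact: bdd_mfunZ|].
    by apply: bdd_mfunX; apply: bdd_mfunB; exact: bdd_mfunM.
  move=> z; rewrite -mulrBl exprMn mulrC ler_wpM2r ?sqr_ge0//.
  rewrite -real_normK ?num_real// (@le_trans _ _ (B ^+ 2)) ?lerDl//.
  by rewrite lerXn2r ?nnegrE// (le_trans _ (qB z)).
by rewrite bdd_RintegralZ// mulrC -ltr_pdivlMr.
Qed.

Lemma approximableC f : approximable f -> approximable (fun z => 1 - f z).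
Proof.
move=> [bf af]; split; first by apply: bdd_mfunB => //; exact: bdd_mfun_cst.
move=> e /af [q tq qf]; exists (fun z => 1 - q z).
  by apply: trigpolyB => //; exact: trigpoly_cst.
rewrite (_ : \int[la]_z _ = \int[la]_z (q z - f z) ^+ 2)//.
by apply: eq_Rintegral => z _; rewrite -sqrrN; congr (_ ^+ 2); ring.
Qed.

Definition approximable_sets :=
  [set A : set (circle R) | measurable A /\ approximable \1_A].

Lemma approximable_sets_setC A :
  approximable_sets A -> approximable_sets (~` A).
Proof.
move=> [mA aA]; split; first exact: measurableC.
rewrite (_ : \1__ = fun z => 1 - \1_A z); first exact: approximableC.
by apply/funext => z; rewrite !indicE in_setC; case: (z \in A);
  rewrite /= ?subrr ?subr0.
Qed.

Lemma approximable_sets_setI A B : approximable_sets A -> approximable_sets B ->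
  approximable_sets (A `&` B).
Proof.
move=> [mA aA] [mB aB]; split; first exact: measurableI.
rewrite (_ : \1__ = fun z => \1_A z * \1_B z); first exact: approximableM.
by apply/funext => z; rewrite !indicE in_setI -natrM mulnb.
Qed.

Lemma approximable_sets_setU A B : approximable_sets A -> approximable_sets B ->
  approximable_sets (A `|` B).
Proof.
move=> aA aB; rewrite -[_ `|` _]setCK setCU; apply: approximable_sets_setC.
by apply: approximable_sets_setI; exact: approximable_sets_setC.
Qed.

Lemma approximable_sets0 : approximable_sets set0.
Proof.
split; first exact: measurable0.
by rewrite indic0; apply: approximable_trigpoly; exact: trigpoly_cst.
Qed.

(** The indicators of the finite unions are eventually constant at each point, so [approximable_lim]
    applies. *)
Lemma approximable_sets_bigcup (F : (set (circle R))^nat) :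
  (forall n, approximable_sets (F n)) -> approximable_sets (\bigcup_n F n).
Proof.
move=> aF; split; first by apply: bigcup_measurable => n _; exact: (aF n).1.
pose G n := \big[setU/set0]_(i < n) F i.
have aG n : approximable_sets (G n).
  rewrite /G; elim: n => [|n ih]; first by rewrite big_ord0;
    exact: approximable_sets0.
  by rewrite big_ord_recr /=; exact: approximable_sets_setU.
apply: (@approximable_lim (fun n => \1_(G n)) _ 1).
- by move=> n; exact: (aG n).2.
- by move=> n z; rewrite indicE; case: (_ \in _); rewrite ?normr1 ?normr0.
- move=> z; apply: cvg_near_cst.
  have [[n _ Fnz]|nz] := pselect ((\bigcup_n F n) z).
    exists n.+1 => // k /= nk; rewrite !indicE !mem_set//; first by exists n.
    by rewrite /G -bigcup_mkord; exists n.
  apply: nearW => k; rewrite !indicE !memNset// /G -bigcup_mkord => -[i _ Fi].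
  by apply: nz; exists i.
Qed.

(** An affine rescaling of [q] takes values in [[0, 1]] and is below [1 / 2] exactly where [q > 0].
    Its step polynomials are trigonometric and converge boundedly to the indicator, including at the
    zeros of [q]. *)
Lemma approximable_sets_trigpoly_gt0 q : trigpoly q ->
  approximable_sets [set z | 0 < q z].
Proof.
move=> tq; have bq := trigpoly_bdd_mfun tq; have [mq [B qB]] := bq.
pose B' := `|B| + 1; have B'0 : 0 < B' by rewrite /B' ltr_wpDl.
pose s z := (1 - B'^-1 * q z) / 2.
have ts : trigpoly s.
  rewrite /s; under eq_fun do rewrite mulrC.
  apply: trigpolyZ; apply: trigpolyB; first exact: trigpoly_cst.
  exact: trigpolyZ.
have s01 z : 0 <= s z <= 1.
  have : `|B'^-1 * q z| <= 1.
    rewrite normrM ger0_norm ?invr_ge0 ?(ltW B'0)// ler_pdivrMl// mulr1.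
    by rewrite (le_trans (qB z))// /B' (le_trans (ler_norm _))// lerDl.
  by rewrite ler_norml /s => /andP[? ?]; apply/andP; split; lra.
have sq z : (s z < 1 / 2)%R = (0 < q z)%R.
  have -> : (0 < q z) = (0 < B'^-1 * q z) by rewrite pmulr_rgt0 ?invr_gt0.
  by rewrite /s; apply/idP/idP; lra.
split.
  rewrite (_ : [set _ | _] = setT `&` q @^-1` `]0, +oo[%classic).
    by apply: mq => //; exact: measurable_itv.
  by apply/seteqP; split => z /=; rewrite in_itv /= andbT; tauto.
apply: (@approximable_lim (fun n z => step_poly n (s z)) _ 1).
- move=> n; apply: approximable_trigpoly; rewrite /step_poly.
  apply: trigpolyX; apply: trigpolyB; first exact: trigpoly_cst.
  exact: trigpolyX.
- by move=> n z; have /andP[? ?] := step_poly_bound n (s01 z); rewrite ger0_norm.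
- move=> z; have := cvg_step_poly (s01 z); rewrite sq indicE.
  suff -> : (z \in [set z | 0 < q z]) = (0 < q z) by [].
  by apply/idP/idP => [/set_mem|h]; [|apply/mem_set].
Qed.

End density.

(** * From open sets to all Borel sets *)

Section density_open.
Variables (R : realType) (la : {finite_measure set (circle R) -> \bar R}).
Local Notation C := R[i].
Local Notation cv := (@circle_val R).
Implicit Types (z : circle R).

(** An open set is a countable union of traces of discs with rational centre and radius, and each
    trace is the positivity set of a trigonometric polynomial. *)
Lemma approximable_sets_open (U : set (circle R)) :
  open U -> approximable_sets la U.
Proof.
move=> [V oV <-].
pose D (t : rat * rat * rat) := [set z |
  0 < ratr t.2 ^+ 2 - ((complex.Re (cv z) - ratr t.1.1) ^+ 2 +
                       (complex.Im (cv z) - ratr t.1.2) ^+ 2) :> R].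
have aD t : approximable_sets la (D t).
  apply: approximable_sets_trigpoly_gt0.
  apply: trigpolyB; first exact: trigpoly_cst.
  apply: trigpolyD; apply: trigpolyX; apply: trigpolyB; try exact: trigpoly_cst.
    exact: trigpoly_Re.
  exact: trigpoly_Im.
(* Integers that code no disc, or a disc not inside the open set, contribute the empty set. *)
pose F n := if unpickle n is Some t then
  if `[< D t `<=` set_val @^-1` V >] then D t else set0 else set0.
suff -> : set_val @^-1` V = \bigcup_n F n.
  apply: approximable_sets_bigcup => n; rewrite /F.
  case: unpickle => [t|]; last exact: approximable_sets0.
  by case: asboolP => _; [exact: aD|exact: approximable_sets0].
apply/seteqP; split => [z Vz|z [n _]]; last first.
  by rewrite /F; case: unpickle => // t; case: asboolP => // h /h.
have : nbhs (set_val z : C^o) V.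
  by apply: open_nbhs_nbhs; split.
move=> /nbhs_normP[e0 /= e00 eV].
have [e e0E] : exists e : R, e0 = e%:C.
  by apply/complex_realP; rewrite ger0_real// ltW.
subst e0; have e0 : 0 < e by rewrite -(ltcR 0 e).
(* Two points of a disc of radius [r] have squared distance at most [4 r^2 < e^2]. Rounding each
   coordinate of [z] by less than [r / 2] keeps [z] in the disc. *)
have [r /[!in_itv]/= /andP[r0 re]] : exists r : rat, ratr r \in `]0, (e / 2)[.
  by apply: rat_in_itvoo; rewrite divr_gt0.
have rr (x : R) : exists a : rat, `|x - ratr a| < ratr r / 2 :> R.
  have [|a] := @rat_in_itvoo R (x - ratr r / 2) (x + ratr r / 2); first by lra.
  by rewrite in_itv /= => /andP[h1 h2]; exists a; rewrite ltr_norml;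
    apply/andP; split; lra.
have [a ha] := rr (complex.Re (cv z)); have [b hb] := rr (complex.Im (cv z)).
have sq (x : R) : `|x| < ratr r / 2 -> x ^+ 2 < ratr r ^+ 2 / 4 :> R.
  move=> h; rewrite -real_normK ?num_real//.
  have -> : ratr r ^+ 2 / 4 = (ratr r / 2) ^+ 2 :> R by field.
  by rewrite ltrXn2r// nnegrE//; lra.
have Dz : D (a, b, r) z.
  have r2 : 0 < ratr r ^+ 2 :> R by rewrite exprn_gt0.
  by rewrite /D /=; have := sq _ ha; have := sq _ hb; lra.
exists (pickle (a, b, r)); first exact: I.
rewrite /F pickleK; case: asboolP => [_|[z' Dz']]; first exact: Dz.
apply: eV; clear e00 => /=; rewrite normc_def ltcR.
have -> : e = Num.sqrt (e ^+ 2) by rewrite sqrtr_sqr ger0_norm// ltW.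
rewrite ltr_sqrt ?exprn_gt0//.
rewrite -/(nsq _) -[_ - _]/(cv z - cv z').
pose w : C := ratr a +i* ratr b.
have -> : cv z - cv z' = (cv z - w) - (cv z' - w) by ring.
apply: (le_lt_trans (nsqB_le _ _)).
have h1 : nsq (cv z - w) < ratr r ^+ 2 by move: Dz; rewrite /D /nsq !ReImE /=; lra.
have h2 : nsq (cv z' - w) < ratr r ^+ 2 by move: Dz';
  rewrite /D /nsq !ReImE /=; lra.
have h3 : (ratr r : R) ^+ 2 < (e / 2) ^+ 2
  by rewrite -subr_gt0 subr_sqr mulr_gt0 ?subr_gt0// addr_gt0// divr_gt0.
have -> : e ^+ 2 = 4 * (e / 2) ^+ 2 by field.
lra.
Qed.

(** The approximable sets form a sigma-algebra containing the open sets. *)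
Lemma approximable_sets_measurable (A : set (circle R)) :
  measurable A -> approximable_sets la A.
Proof.
move: A; apply: smallest_sub.
  split.
  - exact: approximable_sets0.
  - by move=> A; rewrite setTD; exact: approximable_sets_setC.
  - exact: approximable_sets_bigcup.
exact: approximable_sets_open.
Qed.

Lemma trigpoly_dense_indic (A : set (circle R)) e : measurable A -> 0 < e ->
  exists2 q, trigpoly q & \int[la]_z (q z - \1_A z) ^+ 2 < e.
Proof. by move=> /approximable_sets_measurable[_ [_ h]] /h. Qed.

End density_open.

(** * Moments of the circle measure and the Toeplitz form *)

Section trig_integral.
Variable R : realType.
Local Notation leb := (@lebesgue_measure R).

Lemma is_derive_comp_mul (F : R -> R) (dF : R) (c x : R) :
  is_derive (c * x) 1 F dF ->
    is_derive x 1 (fun y => c^-1 * F (c * y)) (c^-1 * (dF * c)).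
Proof.
move=> dFx; apply: (@is_deriveZ _ _ _ (F \o (fun y => c * y)) c^-1 x 1).
apply: is_derive1_comp.
have h : is_derive x 1 (c \*: (id : R ->
  R^o)) (c *: (1 : R^o)) by exact: is_deriveZ.
by rewrite -[X in is_derive _ _ _ X]mulr1.
Qed.

Lemma Rintegral_01_derive_mul (F f : R -> R) (c : R) : c != 0 ->
  continuous F -> continuous f -> (forall x : R, is_derive x 1 F (f x)) -> 
  (\int[leb]_(x in `[0, 1]) (f (c * x)))%R = c^-1 * F c - c^-1 * F 0.
Proof.
move=> c0 cF cf dF.
have cm : continuous (fun x : R => c * x).
  by move=> x; apply: cvgMr; exact: cvg_id.
have cfc (g : R -> R) : continuous g -> continuous (fun x => g (c * x)).
  by move=> cg x; apply: continuous_comp; [exact: cm|exact: cg].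
have d (x : R) : is_derive x 1 (fun y => c^-1 * F (c * y)) (f (c * x)).
  have := is_derive_comp_mul (dF (c * x)).
  by rewrite (_ : c^-1 * (f (c * x) * c) = f (c * x))// mulrC -mulrA mulfV// mulr1.
rewrite /Rintegral (@continuous_FTC2 _ _ (fun y => c^-1 * F (c * y)))//=.
- by rewrite mulr1 mulr0.
- by apply: continuous_subspaceT; exact: cfc.
- have ccF : continuous (fun y => c^-1 * F (c * y)).
    by move=> x; apply: cvgMr; exact: (cfc _ cF).
  split.
  + by move=> x _; have [] := d x.
  + by apply: cvg_at_right_filter; exact: ccF.
  + by apply: cvg_at_left_filter; exact: ccF.
- by move=> x _; rewrite derive1E; have [_] := d x.
Qed.

End trig_integral.

(** * Integration against normalized Lebesgue measure *)

Section circle_measure.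
Variable R : realType.
Local Notation C := R[i].
Local Notation cv := (@circle_val R).
Local Notation leb := (@lebesgue_measure R).
Local Notation m := (@circle_measure R).

Let finite_circle_measure : fin_num_fun m.
Proof.
move=> A mA; rewrite ge0_fin_numE//.
apply: (@le_lt_trans _ _ (m setT)); first by rewrite le_measure ?inE.
by rewrite circle_measure_setT ltry.
Qed.

HB.instance Definition _ := @Measure_isFinite.Build _ _ _ m finite_circle_measure.

(** Change of variables for the image measure. The half-open interval is then closed, at the cost of
    a null endpoint, to suit the fundamental theorem of calculus. *)
Lemma Rintegral_circle_measure (f : circle R -> R) : bdd_mfun f ->
  \int[m]_z f z = \int[leb]_(x in `[0, 1]) f (circle_param x).
Proof.
move=> bf; have mp := @measurable_circle_param R.
have mf : measurable_fun setT (EFin \o f) by apply/measurable_EFinP; exact: bf.1.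
have mg : measurable_fun setT (f \o @circle_param R)
  by apply: measurableT_comp mp => //; exact: bf.1.
have mD := @measurable_itv R `[0, 1[.
have intg : (mrestr leb mD).-integrable [set: R] (EFin \o (f \o @circle_param R)).
  apply: measurable_bounded_integrable => //.
    by rewrite /= /mrestr setTI lebesgue_measure_itv/= lte_fin ltr01 ltry.
  have [B fB] := bf.2; exists B; split; first exact: num_real.
  by move=> M BM x _; apply: le_trans (fB _) (ltW BM).
rewrite /Rintegral integral_pushforward//; congr fine.
transitivity (\int[mrestr leb mD]_(x in `[0%R, 1%R[) (f (circle_param x))%:E)%E.
  have mN : measurable (~` ([set` `[0%R : R, 1%R[%O] : set (measurableTypeR R))) by exact: measurableC.
  have N0 : mrestr leb mD (~` `[0%R, 1%R[) = 0%E
    by rewrite /= /mrestr setICl measure0.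
  by rewrite preimage_setT (negligible_integral mN measurableT intg N0) setTD setCK.
rewrite [LHS](@eq_measure_integral _ _ _ _ leb); last first.
  by move=> A mA AD; rewrite /= /mrestr setIidl.
rewrite integral_itv_bndo_bndc//.
by apply/measurable_EFinP; exact: measurable_funTS.
Qed.

End circle_measure.

Section complex_integral.
Context d (T : measurableType d) (R : realType).
Local Notation C := R[i].
Implicit Types (f g : T -> C) (mu : {finite_measure set T -> \bar R}).

Definition bdd_cfun f :=
  bdd_mfun (fun x => complex.Re (f x)) /\ bdd_mfun (fun x => complex.Im (f x)).

Definition Cintegral mu f : C :=
  (\int[mu]_x complex.Re (f x)) +i* (\int[mu]_x complex.Im (f x)).

Lemma bdd_cfunZ f (a : C) : bdd_cfun f -> bdd_cfun (fun x => f x * a).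
Proof.
move=> [bR bI]; split; under eq_fun do rewrite !ReImE.
  by apply: bdd_mfunB; apply: bdd_mfunM => //; exact: bdd_mfun_cst.
by apply: bdd_mfunD; apply: bdd_mfunM => //; exact: bdd_mfun_cst.
Qed.

Lemma bdd_cfun_sum (I : Type) (s : seq I) (F : I -> T -> C) :
  (forall i, bdd_cfun (F i)) -> bdd_cfun (fun x => \sum_(i <- s) F i x).
Proof.
move=> bF; elim: s => [|i s [ihR ihI]].
  by split; under eq_fun do rewrite big_nil; exact: bdd_mfun_cst.
by split; under eq_fun do rewrite big_cons !ReImE; apply: bdd_mfunD => //;
  have [] := bF i.
Qed.

Lemma CintegralZ mu f (a : C) : bdd_cfun f ->
  Cintegral mu (fun x => f x * a) = Cintegral mu f * a.
Proof.
move=> [bR bI]; apply: complex_ext; rewrite !ReImE /=.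
  under eq_Rintegral do rewrite !ReImE mulrC (mulrC (complex.Im (f _))).
  by rewrite bdd_RintegralB; [|exact: bdd_mfunZ|exact: bdd_mfunZ];
    rewrite !bdd_RintegralZ// mulrC [X in _ - X]mulrC.
under eq_Rintegral do rewrite !ReImE mulrC (mulrC (complex.Im (f _))).
by rewrite bdd_RintegralD; [|exact: bdd_mfunZ|exact: bdd_mfunZ];
  rewrite !bdd_RintegralZ// mulrC [X in _ + X]mulrC.
Qed.

Lemma Cintegral_sum mu (I : Type) (s : seq I) (F : I -> T -> C) :
  (forall i, bdd_cfun (F i)) ->
  Cintegral mu (fun x => \sum_(i <- s) F i x) = \sum_(i <- s) Cintegral mu (F i).
Proof.
move=> bF; elim: s => [|i s ih].
  rewrite /Cintegral big_nil; apply: complex_ext => /=;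
  by under eq_Rintegral do rewrite big_nil; rewrite RintegralT_cst mul0r.
have [bR bI] := bdd_cfun_sum s bF; have [bRi bIi] := bF i.
rewrite big_cons -ih; apply: complex_ext; rewrite !ReImE /= -bdd_RintegralD//;
  by apply: eq_Rintegral => x _; rewrite big_cons !ReImE.
Qed.

Lemma charge_CintegralE (nu : {charge set T -> \bar R}) f :
  charge_Cintegral nu f = Cintegral (jordan_pos (hahn_pairP nu)) f
                        - Cintegral (jordan_neg (hahn_pairP nu)) f.
Proof. by apply: complex_ext; rewrite !ReImE. Qed.

End complex_integral.

(** * Orthogonality, Parseval's identity and the form as an integral *)

Section moments.
Variable R : realType.
Local Notation C := R[i].
Local Notation cv := (@circle_val R).
Local Notation m := (@circle_measure R).
Implicit Types (p : {poly C}) (z : circle R).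

Lemma circle_param_pow (x : R) n : cv (circle_param x) ^+ n =
  cos (2 * pi * n%:R * x) +i* sin (2 * pi * n%:R * x).
Proof.
elim: n => [|n ih]; first by rewrite expr0 mulr0 mul0r cos0 sin0.
rewrite exprSr ih.
have -> : cv (circle_param x) = cos (2 * pi * x) +i* sin (2 * pi * x) by [].
have -> : 2 * pi * n.+1%:R * x = 2 * pi * n%:R * x + 2 * pi * x.
  by rewrite -natr1; ring.
by apply: complex_ext; rewrite !ReImE /= ?cosD ?sinD; ring.
Qed.

Lemma bdd_cfun_horner p : bdd_cfun (fun z => p.[cv z]).
Proof. by split; [exact: bdd_mfun_Re|exact: bdd_mfun_Im]. Qed.

Lemma Rintegral_circle_cst (c : R) : \int[m]_z c = c.
Proof.
rewrite RintegralT_cst [X in _ * X](_ : _ = 1) ?mulr1//.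
exact: (congr1 fine (@circle_measure_setT R)).
Qed.

(** For [n > 0] the antiderivatives [sin] and [- cos] take equal values at the ends of [n] full
    periods. *)
Lemma circle_moment n : Cintegral m (fun z => cv z ^+ n) = (n == 0)%:R.
Proof.
have [->|n0] := eqVneq n 0%N.
  apply: complex_ext => /=.
    by rewrite Rintegral_circle_cst.
  by rewrite RintegralT_cst mul0r.
have bX : bdd_cfun (fun z => cv z ^+ n).
  by have := bdd_cfun_horner 'X^n; under eq_fun do rewrite hornerXn.
have [bR bI] := bX.
have c0 : 2 * pi * n%:R != 0 :> R.
  by rewrite !mulf_neq0 ?pnatr_eq0// gt_eqF// pi_gt0.
have sn : sin (2 * pi * n%:R) = 0 :> R.
  have := periodicn (@sinD2pi R) n 0; rewrite add0r sin0 => <-; congr sin.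
  by rewrite -(mulr_natl pi 2) mulr_natr.
have cn : cos (2 * pi * n%:R) = 1 :> R.
  have := periodicn (@cosD2pi R) n 0; rewrite add0r cos0 => E; rewrite -[RHS]E;
    congr cos.
  by rewrite -(mulr_natl pi 2) mulr_natr.
apply: complex_ext => /=; rewrite Rintegral_circle_measure//.
- under eq_Rintegral do rewrite circle_param_pow /=.
  rewrite (@Rintegral_01_derive_mul _ sin cos)//; last 2 first.
  + exact: continuous_sin.
  + exact: continuous_cos.
  by rewrite sn sin0 !mulr0 subrr.
- under eq_Rintegral do rewrite circle_param_pow /=.
  have dcos (x : R) : is_derive x 1 (fun x => - cos x) (sin x).
    have h : is_derive x 1 (- (cos : R -> R^o)) (- (- sin x)) by exact: is_deriveN.
    by rewrite -[sin x]opprK.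
  have cNcos : continuous (fun x : R => - cos x).
    by move=> x; apply: cvgN; exact: continuous_cos.
  rewrite (Rintegral_01_derive_mul c0 cNcos (@continuous_sin R) dcos).
  by rewrite cn cos0 subrr.
Qed.

(** The mean value property at the origin: all positive moments vanish. *)
Lemma Cintegral_horner p : Cintegral m (fun z => p.[cv z]) = p`_0.
Proof.
have bX (i : nat) : bdd_cfun (fun z => cv z ^+ i).
  by have := bdd_cfun_horner 'X^i; under eq_fun do rewrite hornerXn.
have -> : (fun z => p.[cv z]) = (fun z => \sum_(i < size p) cv z ^+ i * p`_i).
  by apply/funext => z; rewrite horner_coef; apply: eq_bigr => i _; rewrite mulrC.
rewrite Cintegral_sum; last by move=> i; exact: bdd_cfunZ.
under eq_bigr do rewrite CintegralZ ?circle_moment//.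
have [/eqP|] := posnP (size p).
  by rewrite size_poly_eq0 => /eqP ->; rewrite size_poly0 big_ord0 coef0.
case: (size p) => // n _; rewrite big_ord_recl /= mul1r big1 ?addr0//.
by move=> i _; rewrite mul0r.
Qed.

Lemma bdd_cfun_zpow (k : int) : bdd_cfun (fun z => cv z ^ k).
Proof.
have bX (i : nat) : bdd_cfun (fun z => cv z ^+ i).
  by have := bdd_cfun_horner 'X^i; under eq_fun do rewrite hornerXn.
case: k => n; first exact: bX.
have zV z : cv z ^ (Negz n) = (cv z ^+ n.+1)^*.
  rewrite NegzE -exprnN rmorphXn /= -exprVn; congr (_ ^+ _).
  have z0 : cv z != 0.
    apply/eqP => z0; have := nsq_circle z; rewrite z0 /nsq /= expr0n addr0.
    by move/eqP; rewrite eq_sym oner_eq0.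
  by apply: (mulfI z0); rewrite circleJ mulfV.
have [bR bI] := bX n.+1.
split; under eq_fun do rewrite zV !ReImE; [exact: bR|exact: bdd_mfunN].
Qed.

Lemma zpow_subC z (n k : nat) : cv z ^ (- (n%:Z - k%:Z)) = cv z ^+ k * (cv z ^+ n)^*.
Proof.
have z0 : cv z != 0.
  apply/eqP => z0; have := nsq_circle z; rewrite z0 /nsq /= expr0n addr0.
  by move/eqP; rewrite eq_sym oner_eq0.
rewrite opprB expfzDr// rmorphXn /=; congr (_ * _).
rewrite -exprnN -exprVn; congr (_ ^+ _).
by apply: (mulfI z0); rewrite circleJ mulfV.
Qed.

Lemma nsq_horner_sum p z : (nsq p.[cv z])%:C =
  \sum_(n < size p) \sum_(k < size p) cv z ^ (- (n%:Z - k%:Z)) * (p`_k * (p`_n)^*).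
Proof.
rewrite -mul_conjc [X in X * _]horner_coef [X in _ * X^*]horner_coef rmorph_sum /=.
rewrite mulrC big_distrlr /=; apply: eq_bigr => n _; apply: eq_bigr => k _.
by rewrite zpow_subC rmorphM /=; ring.
Qed.

Lemma Cintegral_nsq_horner (mu : {finite_measure set (circle R) -> \bar R}) p :
  (\int[mu]_z nsq p.[cv z])%:C = \sum_(n < size p) \sum_(k < size p)
    Cintegral mu (fun z => cv z ^ (- (n%:Z - k%:Z))) * (p`_k * (p`_n)^*).
Proof.
transitivity (Cintegral mu (fun z => (nsq p.[cv z])%:C)).
  by apply: complex_ext => //=; rewrite RintegralT_cst mul0r.
under [X in Cintegral mu X]eq_fun do rewrite nsq_horner_sum.
rewrite Cintegral_sum => [|n]; last first.
  by apply: bdd_cfun_sum => k; apply: bdd_cfunZ; exact: bdd_cfun_zpow.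
apply: eq_bigr => n _; rewrite Cintegral_sum => [|k]; last first.
  by apply: bdd_cfunZ; exact: bdd_cfun_zpow.
by apply: eq_bigr => k _; rewrite CintegralZ//; exact: bdd_cfun_zpow.
Qed.

(** Parseval's identity: in the double sum of moments only the diagonal survives. *)
Lemma Rintegral_nsq_circle_measure p :
  \int[m]_z nsq p.[cv z] = \sum_(n < size p) nsq p`_n.
Proof.
apply: complexI; rewrite Cintegral_nsq_horner rmorph_sum /=; apply: eq_bigr => n _.
rewrite (bigD1 n)//= subrr oppr0 big1 ?addr0.
  have -> : Cintegral m (fun z => cv z ^ 0) = 1 by exact: (circle_moment 0).
  by rewrite mul1r mul_conjc.
move=> k kn; suff ->
  : Cintegral m (fun z => cv z ^ (- (n%:Z - k%:Z))) = 0 by rewrite mul0r.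
(* For [n <= k] the exponent is a natural number; otherwise the moment is the conjugate of one with
   natural exponent. *)
have [nk|kn'] := leqP n k.
  under [X in Cintegral m X]eq_fun do rewrite opprB subzn//.
  rewrite circle_moment subn_eq0 leqNgt ltn_neqAle nk andbT eq_sym.
  by rewrite (_ : (val k == val n) = false)//; exact: negbTE.
have -> : Cintegral m (fun z => cv z ^ (- (n%:Z - k%:Z))) =
   (Cintegral m (fun z => cv z ^+ (n - k)))^*.
  have zV z : cv z ^ (- (n%:Z - k%:Z)) = (cv z ^+ (n - k))^*.
    rewrite zpow_subC -{1}(subnK (ltnW kn')) exprD rmorphM /= mulrCA.
    by rewrite mul_conjc nsqX nsq_circle expr1n mulr1.
  have [_ bI] : bdd_cfun (fun z => cv z ^+ (n - k)).
    by have := bdd_cfun_horner 'X^(n - k); under eq_fun do rewrite hornerXn.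
  apply: complex_ext; rewrite ?ReImE /=.
    by apply: eq_Rintegral => z _; rewrite zV ReJ.
  under eq_Rintegral do rewrite zV ImJ -mulN1r.
  by rewrite bdd_RintegralZ// mulN1r.
by rewrite circle_moment subn_eq0 leqNgt kn'; apply: complex_ext; rewrite /= ?oppr0.
Qed.

Lemma l2norm_coef p :
  l2norm (fun n => p`_n) ^+ 2 = \int[m]_z nsq p.[cv z].
Proof.
rewrite /l2norm Rintegral_nsq_circle_measure.
(* The partial sums are constant from index [size p] on. *)
have -> : limn (series (fun n => Normc.normc p`_n ^+ 2)) = \sum_(n < size p) nsq p`_n.
  apply/cvg_lim => //; apply: cvg_near_cst; exists (size p) => // k /= pk.
  rewrite /series /= -(big_mkord xpredT (fun n => nsq p`_n)).
  rewrite (big_cat_nat _ pk) //= [X in _ + X]big_nat_cond [X in _ + X]big1 ?addr0.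
    by apply: eq_bigr => i _; rewrite nsq_normc.
  move=> i /andP[/andP[pi _] _]; rewrite nth_default//.
  by rewrite nsq_normc /nsq /= expr0n addr0.
by rewrite sqr_sqrtr//; apply: sumr_ge0 => i _; exact: nsq_ge0.
Qed.

Lemma toeplitz_form_coef (t : int -> C) p : toeplitz_form t (fun n => p`_n) =
  \sum_(n < size p) \sum_(k < size p) t (n%:Z - k%:Z) * (p`_k * (p`_n)^*).
Proof.
rewrite /toeplitz_form (fsbigE (index_iota 0 (size p))); first last.
- move=> n _; rewrite mem_index_iota -leqNgt /= => pn; apply: fsbig1 => k _.
  by rewrite (nth_default _ pn) rmorph0 mulr0.
- by [].
- exact: iota_uniq.
under eq_bigl do rewrite in_setT.
rewrite big_mkord; apply: eq_bigr => n _.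
rewrite (fsbigE (index_iota 0 (size p))); first last.
- move=> k _; rewrite mem_index_iota -leqNgt /= => pk.
  by rewrite (nth_default _ pk) mulr0 mul0r.
- by [].
- exact: iota_uniq.
under eq_bigl do rewrite in_setT.
by rewrite big_mkord; apply: eq_bigr => k _; rewrite mulrA.
Qed.

(** The double sum of moments obtained by expanding [|p|^2] is exactly the Toeplitz sum, for each
    Jordan part separately. *)
Lemma toeplitz_form_charge (t : int -> C) (M : {charge set (circle R) ->
  \bar R}) p :
  (forall n, t n = charge_Cintegral M (fun z : circle R => cv z ^ (- n))) ->
  toeplitz_form t (fun n => p`_n) =
  (\int[jordan_pos (hahn_pairP M)]_z nsq p.[cv z]
   - \int[jordan_neg (hahn_pairP M)]_z nsq p.[cv z])%:C.
Proof.
move=> tE; rewrite toeplitz_form_coef rmorphB /= !Cintegral_nsq_horner -sumrB.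
apply: eq_bigr => n _; rewrite -sumrB; apply: eq_bigr => k _.
by rewrite tE charge_CintegralE mulrBl.
Qed.

Lemma finitely_supportedP (g : nat -> C) :
  finitely_supported g <-> exists p : {poly C}, g = (fun n => p`_n).
Proof.
split=> [fg|[p ->]]; last first.
  apply: (@sub_finite_set _ _ `I_(size p)); last exact: finite_II.
  by move=> n /= pn; rewrite ltnNge; apply: contra pn => /(nth_default 0) ->.
have [N hN] : exists N, forall n, (N <= n)%N -> g n = 0.
  have /finite_seqP[s hs] := fg.
  exists (\max_(i <- s) i).+1 => n Nn; apply: contrapT => /eqP gn.
  have : [set` s] n by rewrite -hs.
  by move=> /= ns; have := @leq_bigmax_seq _ s xpredT id n ns isT;
    rewrite leqNgt Nn.
exists (\poly_(i < N) g i); apply/funext => n; rewrite coef_poly.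
by case: ltnP => // /hN.
Qed.

End moments.

(** * The measure of the shifted form *)

Section nonneg_charge.
Context d (T : measurableType d) (R : realType).

(** The whole space and the empty set form a Hahn decomposition, whose positive Jordan part is the
    required measure. *)
Lemma nonneg_charge_measure (nu : {charge set T -> \bar R}) :
  (forall A, measurable A -> (0 <= nu A)%E) ->
  exists mu : {finite_measure set T -> \bar R}, forall A, measurable A ->
    mu A = nu A.
Proof.
move=> nu0; have h : hahn_decomposition nu setT set0.
  split; [|exact: negative_set0|by rewrite setU0|by rewrite setI0].
  by split => // A mA _; exact: nu0.
exists (jordan_pos h) => A mA;
  rewrite [LHS](jordan_posE h A) cjordan_posE /= /crestr0 mem_set//.
by rewrite /crestr setIT.
Qed.

Lemma finite_measure_add (m1 m2 : {finite_measure set T -> \bar R}) :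
  exists mu : {finite_measure set T -> \bar R},
    forall A, measurable A -> mu A = (m1 A + m2 A)%E.
Proof.
pose nu : {charge set T -> \bar R} :=
  cadd (charge_of_finite_measure m1) (charge_of_finite_measure m2).
by have [A mA|mu muE] := @nonneg_charge_measure nu; [exact: adde_ge0|exists mu].
Qed.

End nonneg_charge.

Section indic_approx.
Context d (T : measurableType d) (R : realType).
Variable mu : {finite_measure set T -> \bar R}.

(** With [b] the indicator, [q^2 - b = (q - b)^2 + 2 b (q - b)], and the cross term is at most
    [(q - b)^2 / s + s] in absolute value. Integration gives [s^2 + s + s mu(T)], and [s <= 1]
    yields the bound. *)
Lemma Rintegral_sqr_indic_close (q : T -> R) (A : set T) (s : R) :
  bdd_mfun q -> measurable A -> 0 < s <= 1 ->
  \int[mu]_x (q x - \1_A x) ^+ 2 <= s ^+ 2 ->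
  `|\int[mu]_x q x ^+ 2 - fine (mu A)| <= s * (2 + fine (mu setT)).
Proof.
move=> bq mA /andP[s0 s1] qs.
have bA := @bdd_mfun_indic _ T R A mA; set b : T -> R := \1_A in bA qs *.
have bqA : bdd_mfun (fun x => (q x - b x) ^+ 2) by apply: bdd_mfunX;
  exact: bdd_mfunB.
have bq2 : bdd_mfun (fun x => q x ^+ 2) by exact: bdd_mfunX.
have bs : bdd_mfun (fun _ : T => s) by exact: bdd_mfun_cst.
have b2 x : b x ^+ 2 = b x by rewrite /b indicE; case: (x \in A);
  rewrite ?expr1n ?expr0n.
have b1 x : b x <= 1 by rewrite /b indicE; case: (x \in A).
have key x : `|q x ^+ 2 - b x| <= (1 + s^-1) * (q x - b x) ^+ 2 + s.
  have e : q x ^+ 2 - b x = (q x - b x) ^+ 2 + 2 * b x * (q x - b x).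
    by rewrite -[in LHS](b2 x); ring.
  rewrite e; set y := q x - b x; have := sqr_ge0 y.
  have : s * (s^-1 * y ^+ 2) = y ^+ 2 by rewrite mulrA mulfV ?mul1r// gt_eqF.
  set w := s^-1 * y ^+ 2 => sw y2.
  have sw0 : 0 <= w by rewrite mulr_ge0// invr_ge0 ltW.
  (* After multiplication by [s] the difference is a square plus [s^2 (1 - b^2)], which is
     nonnegative. *)
  have h1 : 2 * b x * y <= w + s.
    rewrite -subr_ge0 -(pmulr_rge0 _ s0).
    have -> : s * (w + s - 2 * b x * y) = (y - s * b x) ^+ 2
      + s ^+ 2 * (1 - b x ^+ 2).
      by rewrite mulrBr mulrDr sw; ring.
    by rewrite addr_ge0 ?sqr_ge0// mulr_ge0 ?sqr_ge0// b2 subr_ge0.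
  have h2 : - (2 * b x * y) <= w + s.
    rewrite -subr_ge0 -(pmulr_rge0 _ s0).
    have -> : s * (w + s - - (2 * b x * y)) = (y + s * b x) ^+ 2
      + s ^+ 2 * (1 - b x ^+ 2).
      by rewrite mulrBr mulrDr sw; ring.
    by rewrite addr_ge0 ?sqr_ge0// mulr_ge0 ?sqr_ge0// b2 subr_ge0.
  have -> : (1 + s^-1) * y ^+ 2 = y ^+ 2 + w by rewrite mulrDl mul1r.
  by rewrite ler_norml; apply/andP; split; lra.
have i1 : \int[mu]_x (q x ^+ 2 - b x) = \int[mu]_x q x ^+ 2 - fine (mu A).
  by rewrite bdd_RintegralB// Rintegral_indic.
rewrite -i1 (le_trans (le_normr_Rintegral _ _))//.
  by apply: bdd_mfun_integrable; exact: bdd_mfunB.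
have bn : bdd_mfun (fun x => `|q x ^+ 2 - b x|).
  have [mf [B fB]] := bdd_mfunB bq2 bA; split; first exact: measurableT_comp.
  by exists B => x; rewrite normr_id.
apply: (le_trans (le_bdd_Rintegral mu bn _ key));
  first by apply: bdd_mfunD => //; exact: bdd_mfunZ.
rewrite bdd_RintegralD//; last exact: bdd_mfunZ.
rewrite bdd_RintegralZ// RintegralT_cst.
have s1' : 0 <= 1 + s^-1 by rewrite addr_ge0// invr_ge0 ltW.
apply: (@le_trans _ _ ((1 + s^-1) * s ^+ 2 + s * fine (mu setT))).
  by rewrite lerD2r ler_wpM2l.
rewrite mulrDr lerD2r mulrDl mul1r expr2 mulrA mulVf ?gt_eqF// mul1r.
by nra.
Qed.

End indic_approx.

Section form_measure.
Variables (R : realType) (t : int -> R[i]) (gamma delta : R).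
Local Notation m := (@circle_measure R).
Hypothesis t_semibounded : forall g : nat -> R[i], finitely_supported g ->
      (gamma * l2norm g ^+ 2)%:C <= toeplitz_form t g.
Variable M : {charge set (circle R) -> \bar R}.
Hypothesis M_moments : forall n : int,
      t n = charge_Cintegral M (fun z : circle R => circle_val z ^ (- n)).
Hypothesis gamma_delta : 1 <= gamma + delta.

Let Mp := jordan_pos (hahn_pairP M).
Let Mn := jordan_neg (hahn_pairP M).

Lemma fine_jordan A : measurable A -> fine (M A) = fine (Mp A) - fine (Mn A).
Proof.
move=> mA; rewrite (jordan_decomp (hahn_pairP M) mA) /cadd /= cscaleN1.
by rewrite fineB// fin_num_measure.
Qed.

(** The square of [q] is some [|p|^2], so semiboundedness gives the factor [gamma] and the shift
    raises it to [gamma + delta >= 1]. *)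
Let form_trigpoly q : trigpoly q ->
  \int[m]_z q z ^+ 2 <= \int[Mp]_z q z ^+ 2 - \int[Mn]_z q z ^+ 2
                        + delta * \int[m]_z q z ^+ 2.
Proof.
move=> /trigpoly_sqr[p /funext ->].
have aux (N a b : R) : gamma * N <= a - b -> 0 <= (gamma + delta - 1) * N ->
  N <= a - b + delta * N by lra.
apply: aux.
  have := t_semibounded ((finitely_supportedP _).2 (ex_intro _ p erefl)).
  by rewrite l2norm_coef (toeplitz_form_charge _ M_moments) lecR.
by rewrite mulr_ge0 ?subr_ge0//; apply: RintegralT_ge0 => z; exact: nsq_ge0.
Qed.

(** The inequality for squares of trigonometric polynomials passes to indicators by density. One
    polynomial must serve [Mp], [Mn] and [m] together, so the approximation is done in L2 of their
    sum [la]. *)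
Lemma form_charge_ge A : measurable A ->
  fine (m A) <= fine (M A) + delta * fine (m A).
Proof.
move=> mA; rewrite fine_jordan//; apply/ler_addgt0Pr => e e0.
have [la1 la1E] := finite_measure_add Mp Mn.
have [la laE'] := finite_measure_add la1 m.
(* Each of the three integrals is off by at most [s (2 + la(T))], and the integral against [m]
   occurs once more with weight [delta]. *)
pose K := (3 + `|delta|) * (2 + fine (la setT)).
have la0 (rho : {finite_measure set (circle R) -> \bar R}) : 0 <= fine (rho setT).
  by rewrite fine_ge0.
have K0 : 0 < K.
  have := la0 la; have := normr_ge0 delta => ? ?.
  by rewrite /K mulr_gt0//; lra.
pose s := Num.min 1 (e / K).
have s01 : 0 < s <= 1 by rewrite /s lt_min ltr01 divr_gt0//= ge_min lexx.
have sK : s * K <= e by rewrite -ler_pdivlMr// /s ge_min lexx orbT.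
have [s0 s1] := andP s01.
have [|q tq qs] := @trigpoly_dense_indic _ la A (s ^+ 2) mA;
  first by rewrite exprn_gt0.
have bq := trigpoly_bdd_mfun tq.
have bqA : bdd_mfun (fun x => (q x - \1_A x) ^+ 2).
  by apply: bdd_mfunX; apply: bdd_mfunB => //; exact: bdd_mfun_indic.
have close (rho : {finite_measure set (circle R) -> \bar R}) :
    (forall B, measurable B -> fine (rho B) <= fine (la B)) ->
    `|\int[rho]_x q x ^+ 2 - fine (rho A)| <= s * (2 + fine (la setT)).
  move=> rla; apply: (@le_trans _ _ (s * (2 + fine (rho setT)))); last first.
    by rewrite ler_wpM2l ?(ltW s0)// lerD2l rla.
  apply: Rintegral_sqr_indic_close => //; apply: le_trans (ltW qs).
  rewrite -[leRHS]mul1r (@eq_Rintegral _ _ _ rho setT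
    (fun x => (q x - \1_A x) ^+ 2 * \1_[set: circle R] x)).
    apply: le_bdd_Rintegral_measure => //; first by move=> B mB _;
      rewrite mul1r; exact: rla.
    by move=> x; exact: sqr_ge0.
  by move=> x _; rewrite indicT mulr1.
have laE B : measurable B -> fine (la B) = fine (Mp B) + fine (Mn B) + fine (m B).
  by move=> mB; rewrite laE'// fineD ?fin_num_measure// la1E// fineD ?fin_num_measure.
have f0 (rho : {finite_measure set (circle R) -> \bar R}) B : 0 <= fine (rho B).
  by rewrite fine_ge0.
have cp := close Mp; have cn := close Mn; have cm := close m.
set c := s * (2 + _) in cp cn cm.
have {}cp : `|\int[Mp]_x q x ^+ 2 - fine (Mp A)| <= c.
  by apply: cp => B mB; rewrite laE//; have := f0 Mn B; have := f0 m B; lra.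
have {}cn : `|\int[Mn]_x q x ^+ 2 - fine (Mn A)| <= c.
  by apply: cn => B mB; rewrite laE//; have := f0 Mp B; have := f0 m B; lra.
have {}cm : `|\int[m]_x q x ^+ 2 - fine (m A)| <= c.
  by apply: cm => B mB; rewrite laE//; have := f0 Mp B; have := f0 Mn B; lra.
have dm : delta * \int[m]_x q x ^+ 2 <= delta * fine (m A) + `|delta| * c.
  rewrite -lerBlDl -mulrBr (le_trans (ler_norm _))// normrM ler_wpM2l//.
have aux (a b N x y w dN dw : R) : `|a - x| <= c -> `|b - y| <= c ->
    `|N - w| <= c -> dN <= dw + `|delta| * c -> N <= a - b + dN ->
    (3 + `|delta|) * c <= e -> w <= x - y + dw + e.
  by rewrite !ler_norml => /andP[? ?] /andP[? ?] /andP[? ?] *; lra.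
apply: aux cp cn cm dm (form_trigpoly tq) _.
by rewrite /c mulrCA.
Qed.

(** The charge [M + delta m] dominates [m], hence is a positive measure. Its last property makes
    [form_norm] the L2 norm for [mu]. *)
Lemma form_measure : exists mu : {finite_measure set (circle R) -> \bar R},
  [/\ forall A, measurable A -> fine (mu A) = fine (M A) + delta * fine (m A),
      forall A, measurable A -> fine (m A) <= fine (mu A) &
      forall p : {poly R[i]}, \int[mu]_z nsq p.[circle_val z] =
        complex.Re (toeplitz_form t (fun n => p`_n))
          + delta * l2norm (fun n => p`_n) ^+ 2].
Proof.
pose nu : {charge set (circle R) -> \bar R} :=
  cadd M (cscale delta (charge_of_finite_measure m)).
have nuE A : measurable A -> nu A = (fine (M A) + delta * fine (m A))%:E.
  move=> mA; rewrite /nu /= /cadd /cscale /charge_of_finite_measure /=.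
  by rewrite EFinD EFinM !fineK ?fin_num_measure// fin_num_measure.
have [A mA|mu muE] := nonneg_charge_measure (nu := nu).
  by rewrite nuE// lee_fin; apply: le_trans (form_charge_ge mA); rewrite fine_ge0.
have muE' A : measurable A -> fine (mu A) = fine (M A) + delta * fine (m A).
  by move=> mA; rewrite muE// nuE.
exists mu; split => //; first by move=> A mA; rewrite muE'//; exact: form_charge_ge.
move=> p; rewrite (toeplitz_form_charge _ M_moments) l2norm_coef /=.
apply: bdd_Rintegral_measure_lin => [A mA||z]; last exact: nsq_ge0.
  by rewrite muE'// fine_jordan.
exact: bdd_mfun_nsq.
Qed.

End form_measure.

(** * Analytic approximation of indicators of null sets *)

Section rn_split.
Context d (T : measurableType d) (R : realType).
Variables (mu m : {finite_measure set T -> \bar R}).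

(** Let [h] be the density of [m] with respect to [mu], and [Z] the set where [h <= 0], which is
    m-null. Where [h >= 1 / (n + 1)] one has [mu <= (n + 1) m], and these sets exhaust the
    complement of [Z]. *)
Lemma density_split : m `<< mu -> exists Z : set T,
  [/\ measurable Z, m Z = 0%E & forall e : R, 0 < e ->
    exists E : set T, exists c : R,
    [/\ measurable E, E `&` Z = set0, 0 <= c,
        fine (mu (~` (Z `|` E))) < e &
        forall A, measurable A -> A `<=` E -> fine (mu A) <= c * fine (m A)]].
Proof.
move=> mmu; pose nu := charge_of_finite_measure m.
have numu : nu `<< mu by [].
pose h := Radon_Nikodym nu mu.
have hfin x : h x \is a fin_num by exact: Radon_Nikodym_fin_num.
have hint : mu.-integrable setT h by exact: Radon_Nikodym_integrable.
have hE A : measurable A -> m A = (\int[mu]_(x in A) h x)%E.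
  by move=> mA; exact: (@Radon_Nikodym_integral _ _ _ nu mu A numu mA).
have mh : measurable_fun setT h by exact: (measurable_int mu).
have mle a : measurable [set x | (h x <= a)%E].
  rewrite -[X in measurable X]setTI; exact: emeasurable_fun_infty_c.
have mge a : measurable [set x | (a <= h x)%E].
  rewrite -[X in measurable X]setTI; exact: emeasurable_fun_c_infty.
exists [set x | (h x <= 0)%E]; split => //.
  apply/eqP; rewrite eq_le measure_ge0 andbT hE//.
  rewrite -[leRHS](@integral0 _ _ _ mu [set x | (h x <= 0)%E]).
  apply: le_integral => //; first exact: (integrableS measurableT).
    exact: integrable0.
  by move=> x; rewrite inE.
move=> e e0; pose E n := [set x | ((n.+1%:R^-1)%:E <= h x)%E].
pose Z := [set x | (h x <= 0)%E].
pose D n := ~` (Z `|` E n).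
have mD n : measurable (D n) by apply: measurableC; apply: measurableU;
  [exact: mle|exact: mge].
have [_] : bdd_mfun (fun _ : T => 0 : R) /\ \int[mu]_x \1_(D n) x @[n --> \oo] --> \int[mu]_x (0 : R).
  apply: (@bounded_convergence _ _ _ mu _ _ 1).
  - by move=> n; exact: bdd_mfun_indic.
  - by move=> n x; rewrite indicE; case: (_ \in _); rewrite ?normr1 ?normr0.
  - move=> x; apply: cvg_near_cst.
    have [hx|hx] := leP (h x) 0%E.
      by apply: nearW => n; rewrite indicE memNset// => -[]; left.
    have fx : (0 < fine (h x))%R by rewrite fine_gt0// hx ltey_eq hfin.
    have := @near_infty_natSinv_lt R (PosNum fx).
    apply: filterS => n /= hn; rewrite indicE memNset// => -[]; right.
    by rewrite /E /= -(fineK (hfin x)) lee_fin ltW.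
rewrite RintegralT_cst mul0r => /cvgr_lt /(_ e e0) [n _ /(_ n (leqnn n)) hn].
exists (E n), n.+1%:R; split => //.
- exact: mge.
- apply/seteqP; split => // x [/= h1 h2].
  have := le_trans h1 h2; rewrite lee_fin leNgt invr_gt0.
  by rewrite ltr0Sn.
- by move: hn; rewrite Rintegral_indic.
- move=> A mA AE; rewrite -ler_pdivrMl// -lee_fin EFinM !fineK ?fin_num_measure// hE//.
  rewrite -integral_cst//; apply: le_integral => //.
  + by apply: finite_measure_integrable_cst.
  + exact: (integrableS measurableT).
  + by move=> x; rewrite inE => /AE.
Qed.

End rn_split.

(** * Analytic polynomials imitating the exponential *)

Section peak_polynomials.
Variable R : realType.
Local Notation C := R[i].
Local Notation cv := (@circle_val R).
Local Notation m := (@circle_measure R).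

Lemma trigpoly_real_mean q : trigpoly q -> exists2 P : {poly C},
  (forall z, q z = complex.Re P.[cv z]) & P`_0 = (\int[m]_z q z)%:C.
Proof.
move=> [P hP].
(* Removing an imaginary constant keeps the real part and makes [P(0)] real, hence equal to the mean
   of [q]. *)
pose P' := P - (0 +i* complex.Im P`_0)%:P.
have hP' z : q z = complex.Re P'.[cv z].
  by rewrite hornerD hornerN hornerC !ReImE /= subr0.
exists P' => //.
have := Cintegral_horner P'; rewrite /Cintegral => E.
apply: complex_ext; rewrite -E /=; first by apply: eq_Rintegral => z _.
have -> : \int[m]_z complex.Im P'.[cv z] = complex.Im P'`_0 by rewrite -E.
by rewrite coefB coefC /= !ReImE /= subrr.
Qed.

(* The witness [(1 - P / n) ^ n] imitates [exp (- P)], where [q = Re P]. *)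
Lemma exp_peak_poly q (kappa : R) : trigpoly q -> (forall z, 0 <= q z) ->
  0 < kappa <= 1 / 2 ->
  exists p : {poly C},
    (forall z, nsq p.[cv z] <= (1 + 2 * kappa) * expR (- (2 * q z))) /\
    \int[m]_z nsq (1 - p).[cv z] <= 2 * \int[m]_z q z + 2 * kappa.
Proof.
move=> tq q0 /andP[k0 k1].
have [P hP P0] := trigpoly_real_mean tq.
set eps := \int[m]_z q z in P0 *.
have eps0 : 0 <= eps by exact: RintegralT_ge0.
have [_ [B PB]] := bdd_mfun_nsq P.
have {}PB z : nsq P.[cv z] <= B by exact: le_trans (ler_norm _) (PB z).
(* The first bound makes [|P|^2 / n^2] at most [kappa / n]; the second is the condition for
   Bernoulli's inequality at [- eps / n]. *)
have [n [n1 nB ne]] : exists n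
  : nat, [/\ (0 < n)%N, B <= kappa * n%:R & eps <= n%:R].
  have [n hn] : exists n : nat, Num.max (B / kappa) eps <= n%:R.
    by exists (Num.truncn (Num.max (B / kappa) eps)).+1; apply/ltW/truncnS_gt.
  exists n.+1; move: hn; rewrite ge_max => /andP[h1 h2].
  have nn : n%:R <= n.+1%:R :> R by rewrite ler_nat.
  split => //; last exact: le_trans nn.
  by rewrite mulrC -ler_pdivrMr// (le_trans h1).
have nR : 0 < n%:R :> R by rewrite ltr0n.
have nN0 : n%:R != 0 :> R by rewrite gt_eqF.
pose w : {poly C} := 1 - (n%:R^-1 : R)%:C%:P * P.
have key z : nsq (w ^+ n).[cv z] <= (1 + 2 * kappa) * expR (- (2 * q z)).
  have -> : nsq (w ^+ n).[cv z] = nsq w.[cv z] ^+ n by rewrite horner_exp nsqX.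
  pose x := - (2 * q z / n%:R) + kappa / n%:R.
  have wx : nsq w.[cv z] <= 1 + x.
    have -> : nsq w.[cv z] = 1 - 2 * q z / n%:R + nsq P.[cv z] / n%:R ^+ 2.
      rewrite /w hornerD hornerN hornerM !hornerC /nsq hP !ReImE /=.
      by field.
    rewrite /x addrA lerD2l.
    rewrite ler_pdivrMr ?exprn_gt0// expr2 mulrA divfK//.
    exact: le_trans (PB z) nB.
  have ex : 1 + x <= expR x by exact: expR_ge1Dx.
  apply: (@le_trans _ _ (expR x ^+ n)).
    by apply: lerXn2r; rewrite ?nnegrE ?nsq_ge0 ?expR_ge0 ?(le_trans wx ex).
  rewrite -expRM_natl.
  have -> : n%:R * x = kappa - 2 * q z by rewrite /x; field.
  rewrite expRD ler_wpM2r ?expR_ge0//.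
  (* It remains to see [exp kappa <= 1 / (1 - kappa) <= 1 + 2 kappa], where the last step uses
     [kappa <= 1 / 2]. *)
  have e1 : 1 - kappa <= expR (- kappa) by exact: expR_ge1Dx.
  have e2 : expR kappa * expR (- kappa) = 1 by rewrite -expRD subrr expR0.
  have e3 := expR_gt0 kappa.
  have : expR kappa * (1 - kappa) <= 1 by rewrite -[leRHS]e2 ler_wpM2l// ltW.
  move: (expR kappa) e3 => E E0 h.
  have k2 : 0 <= (1 - 2 * kappa) * kappa by apply: mulr_ge0; lra.
  have k3 : 0 < 1 - kappa by lra.
  rewrite -(ler_pM2r k3) (le_trans h)//; nra.
exists (w ^+ n); split => //.
have w0 : (w ^+ n)`_0 = ((1 - eps / n%:R) ^+ n)%:C.
  rewrite -!horner_coef0 horner_exp rmorphXn /=; congr (_ ^+ _).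
  rewrite /w hornerD hornerN hornerM !hornerC horner_coef0 P0.
  by apply: complex_ext; rewrite !ReImE /=; field.
have mw : \int[m]_z complex.Re (w ^+ n).[cv z] = (1 - eps / n%:R) ^+ n.
  by have := Cintegral_horner (w ^+ n); rewrite w0 => -[].
have bern : 1 - eps <= (1 - eps / n%:R) ^+ n.
  have := @bernoulli R (- (eps / n%:R)) n.
  rewrite mulrN mulrCA divff// mulr1; apply.
  by rewrite lerN2 ler_pdivrMr// mul1r.
(* Integrating this expansion bounds the mean by [1 - 2 (1 - eps) + (1 + 2 kappa) = 2 eps + 2
   kappa]. *)
have sqE z : nsq (1 - w ^+ n).[cv z] =
    1 - 2 * complex.Re (w ^+ n).[cv z] + nsq (w ^+ n).[cv z].
  by rewrite hornerD hornerN hornerC /nsq !ReImE /=; ring.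
under eq_Rintegral do rewrite sqE.
have b1 : bdd_mfun (fun z : circle R => 1 : R) by exact: bdd_mfun_cst.
have bR := bdd_mfun_Re (w ^+ n).
have bN := bdd_mfun_nsq (w ^+ n).
have b2 : bdd_mfun (fun z => 1 - 2 * complex.Re (w ^+ n).[cv z]).
  by apply: bdd_mfunB => //; exact: bdd_mfunZ.
rewrite bdd_RintegralD// bdd_RintegralB//; last exact: bdd_mfunZ.
rewrite bdd_RintegralZ// mw Rintegral_circle_cst.
have : \int[m]_z nsq (w ^+ n).[cv z] <= 1 + 2 * kappa.
  rewrite -[leRHS]Rintegral_circle_cst; apply: le_bdd_Rintegral => //;
    first exact: bdd_mfun_cst.
  move=> z; apply: (le_trans (key z)).
  by rewrite ler_piMr//; [lra|rewrite -expR0 ler_expR oppr_le0 mulr_ge0].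
move: bern; lra.
Qed.

End peak_polynomials.

Section analytic_approx.
Variables (R : realType) (mu : {finite_measure set (circle R) -> \bar R}).
Local Notation C := R[i].
Local Notation cv := (@circle_val R).
Local Notation m := (@circle_measure R).
Hypothesis m_le : forall A, measurable A -> fine (m A) <= fine (mu A).
Variable Z : set (circle R).
Hypotheses (mZ : measurable Z) (Z0 : m Z = 0%E).
Hypothesis Zsplit : forall e : R, 0 < e -> exists E : set (circle R), exists c : R,
    [/\ measurable E, E `&` Z = set0, 0 <= c,
        fine (mu (~` (Z `|` E))) < e &
        forall A, measurable A -> A `<=` E -> fine (mu A) <= c * fine (m A)].

Lemma bdd_mfun_nsq_indic (p : {poly C}) : bdd_mfun (fun z => nsq (p.[cv z] - (\1_Z z)%:C)).
Proof.
rewrite /nsq; under eq_fun do rewrite !ReImE /= subr0.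
apply: bdd_mfunD; apply: bdd_mfunX; last exact: bdd_mfun_Im.
by apply: bdd_mfunB; [exact: bdd_mfun_Re|exact: bdd_mfun_indic].
Qed.

(** The values of [f] on [Z] do not affect its m-integral, and [m <= mu] elsewhere. This turns
    closeness to the indicator of [Z] in L2 for [mu] into smallness in L2 for [m]. *)
Lemma le_Rintegral_off_null (f g : circle R -> R) : bdd_mfun f -> bdd_mfun g ->
  (forall z, 0 <= f z) -> (forall z, 0 <= g z) -> (forall z, ~ Z z -> f z = g z) ->
  \int[m]_z f z <= \int[mu]_z g z.
Proof.
move=> bf bg f0 g0 fg.
have bZ := bdd_mfun_indic R mZ; have bNZ := bdd_mfun_indic R (measurableC mZ).
have -> : \int[m]_z f z = \int[m]_z (f z * \1_Z z + g z * \1_(~` Z) z).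
  apply: eq_Rintegral => z _; rewrite !indicE in_setC.
  have [zZ|zZ] := boolP (z \in Z); rewrite /= ?mulr1 ?mulr0 ?addr0 ?add0r// fg//.
  by move=> /mem_set; exact/negP.
rewrite bdd_RintegralD; [|exact: bdd_mfunM|exact: bdd_mfunM].
have h1 : \int[m]_z (f z * \1_Z z) <= 0 * \int[m]_z f z.
  apply: le_bdd_Rintegral_measure => // A mA AZ; rewrite mul0r.
  have mA0 : m A = 0%E.
    by apply/eqP; rewrite eq_le measure_ge0 andbT -Z0 le_measure ?inE.
  by rewrite le_eqVlt; apply/orP; left; apply/eqP; exact: (congr1 fine mA0).
have h2 : \int[m]_z (g z * \1_(~` Z) z) <= 1 * \int[mu]_z g z.
  apply: le_bdd_Rintegral_measure => //; first exact: measurableC.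
  by move=> A mA _; rewrite mul1r; exact: m_le.
by rewrite (le_trans (lerD h1 h2))// mul0r mul1r add0r.
Qed.

(** If [|1 - x| >= 1 / 2], the quadratic term already exceeds the exponential. Otherwise
    [x^2 >= 1 / 4], and [exp y >= 1 + y] bounds the exponential by [2 / A]. *)
Lemma expR_sqr_le (A x : R) : 0 < A ->
  2 * expR (- (2 * (A * x ^+ 2))) <= 4 / A + 8 * (1 - x) ^+ 2.
Proof.
move=> A0.
have -> : 4 / A + 8 * (1 - x) ^+ 2 = 2 * (2 / A + 4 * (1 - x) ^+ 2) by ring.
rewrite ler_pM2l//; have [h|h] := leP 1 (4 * (1 - x) ^+ 2).
  rewrite (@le_trans _ _ 1)//.
    by rewrite -expR0 ler_expR oppr_le0 mulr_ge0// mulr_ge0 ?sqr_ge0// ltW.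
  by rewrite (le_trans h)// lerDr divr_ge0// ltW.
have x2 : 1 / 4 <= x ^+ 2 by nra.
apply: (@le_trans _ _ (2 / A)); last by rewrite lerDl mulr_ge0// sqr_ge0.
have e1 : expR (- (2 * (A * x ^+ 2))) * expR (2 * (A * x ^+ 2)) = 1.
  by rewrite -expRD addNr expR0.
have e2 := expR_ge1Dx (2 * (A * x ^+ 2)).
have e3 := expR_gt0 (- (2 * (A * x ^+ 2))).
rewrite ler_pdivlMr//.
have Ax : A / 2 <= 2 * (A * x ^+ 2) by nra.
move: e1 e2 e3; set u := expR (- _); set v := expR _ => e1 e2 e3.
have : u * (A / 2) <= u * v by rewrite ler_wpM2l ?(ltW e3)//; lra.
by rewrite e1; lra.
Qed.

(** The approximant is [1 - p1], with [p1] the peak polynomial of [A q^2]. On [Z] the polynomial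
    [p1] is small because [q] is near 1; on [E] the measure [mu] is at most [c m] and [p1] is near 1
    in L2 for [m]; the rest [D] has small measure and [|1 - p1|^2 <= 6] there. *)
Lemma indic_approx_analytic e : 0 < e ->
  exists p : {poly C}, \int[mu]_z nsq (p.[cv z] - (\1_Z z)%:C) < e.
Proof.
move=> e0; pose Th := fine (mu setT).
have Th0 : 0 <= Th by rewrite fine_ge0.
have e60 : 0 < e / 60 by rewrite divr_gt0.
have [E [c [mE EZ c0 hD hE]]] := Zsplit e60.
set D := ~` (Z `|` E) in hD.
have mD : measurable D by apply: measurableC; exact: measurableU.
(* The constants [A], [zeta] and [kappa] give error bounds [2 e / 10] on [E], [6 e / 60] on [D], and
   [e / 10] for each of the two terms coming from [Z]. *)
pose A := 40 * (Th + 1) / e.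
have A0 : 0 < A by rewrite /A divr_gt0// mulr_gt0//; lra.
pose zeta := Num.min (e / 80) (e / (20 * (c + 1) * A)).
have c1 : 0 < c + 1 by lra.
have zeta0 : 0 < zeta.
  rewrite /zeta lt_min; apply/andP; split; first by rewrite divr_gt0.
  by rewrite divr_gt0// mulr_gt0// mulr_gt0.
have zeta1 : 8 * zeta <= e / 10.
  have : zeta <= e / 80 by rewrite /zeta ge_min lexx.
  by lra.
have zeta2 : 2 * (c + 1) * A * zeta <= e / 10.
  have : zeta <= e / (20 * (c + 1) * A) by rewrite /zeta ge_min lexx orbT.
  rewrite ler_pdivlMr; last by rewrite mulr_gt0// mulr_gt0.
  move=> h; have -> : 2 * (c + 1) * A * zeta = zeta * (20 * (c
    + 1) * A) / 10 by field.
  by rewrite ler_wpM2r// invr_ge0.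
pose kappa := Num.min (1 / 2) (e / (20 * (c + 1))).
have kappa01 : 0 < kappa <= 1 / 2.
  rewrite /kappa lt_min ge_min lexx /= andbT; apply/andP; split; first lra.
  by rewrite divr_gt0// mulr_gt0.
have kappa2 : 2 * (c + 1) * kappa <= e / 10.
  have : kappa <= e / (20 * (c + 1)) by rewrite /kappa ge_min lexx orbT.
  rewrite ler_pdivlMr ?mulr_gt0// => h.
  have -> : 2 * (c + 1) * kappa = kappa * (20 * (c + 1)) / 10 by field.
  by rewrite ler_wpM2r// invr_ge0.
have [k0 k1] := andP kappa01.
have kk : 1 + 2 * kappa <= 2 by lra.
have kk0 : 0 <= 1 + 2 * kappa by lra.
have aux6 (a : R) : a <= 2 -> 2 * 1 + 2 * a <= 6 by lra.
have hA : 0 <= 4 / A by rewrite divr_ge0// ltW.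
have hTh : 4 / A * Th <= e / 10.
  have -> : 4 / A * Th = e / 10 * (Th / (Th + 1)).
    by rewrite /A; field; rewrite !gt_eqF//; lra.
  by rewrite ler_piMr ?divr_ge0 ?(ltW e0)// ler_pdivrMr; lra.
have hc : c * (2 * (A * zeta) + 2 * kappa) <= e / 10 + e / 10.
  have : 0 <= A * zeta by rewrite mulr_ge0// ltW.
  by move: zeta2 kappa2 k0;
    move: (A * zeta) (mulrA (2 * (c + 1)) A zeta) => x <-; nra.
have fin (a1 a2 a3 a4 : R) : a1 <= e / 10 + e / 10 -> a2 < e / 60 -> a3 <= e / 10 ->
    a4 < zeta -> a1 + 6 * a2 + (a3 + 8 * a4) < e by lra.
have [q tq qZ] := trigpoly_dense_indic mu mZ zeta0.
have bq := trigpoly_bdd_mfun tq.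
have bqZ : bdd_mfun (fun z => (q z - \1_Z z) ^+ 2).
  by apply: bdd_mfunX; apply: bdd_mfunB => //; exact: bdd_mfun_indic.
have tu : trigpoly (fun z => A * q z ^+ 2) by apply: trigpolyZ; exact: trigpolyX.
have [p1 [hp1 mp1]] := exp_peak_poly tu (fun z => mulr_ge0 (ltW A0) (sqr_ge0 _)) kappa01.
(* Off the m-null set [Z], [q] equals its error [q - 1_Z], so its mean square for [m] is below
   [zeta]. *)
have mq : \int[m]_z (A * q z ^+ 2) <= A * zeta.
  rewrite bdd_RintegralZ; last exact: bdd_mfunX.
  rewrite ler_wpM2l ?(ltW A0)// (le_trans _ (ltW qZ))//.
  apply: le_Rintegral_off_null => //; first exact: bdd_mfunX.
  - by move=> z; exact: sqr_ge0.
  - by move=> z; exact: sqr_ge0.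
  - by move=> z nZ; rewrite indicE memNset// subr0.
have p1E z : nsq p1.[cv z] <= 4 / A + 8 * (1 - q z) ^+ 2.
  rewrite (le_trans (hp1 z))//.
  apply: (@le_trans _ _ (2 * expR (- (2 * (A * q z ^+ 2))))).
    by rewrite ler_wpM2r ?expR_ge0.
  exact: expR_sqr_le.
have p1b z : nsq p1.[cv z] <= 2.
  rewrite (le_trans (hp1 z))// -[leRHS]mulr1; apply: ler_pM; rewrite ?expR_ge0//.
  by rewrite -expR0 ler_expR oppr_le0 mulr_ge0// mulr_ge0 ?sqr_ge0// ltW.
exists (1 - p1).
have bnp := bdd_mfun_nsq (1 - p1).
have bE := bdd_mfun_indic R mE; have bD := bdd_mfun_indic R mD.
have bEp : bdd_mfun (fun z => nsq (1 - p1).[cv z] * \1_E z) by exact: bdd_mfunM.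
have key z : nsq ((1 - p1).[cv z] - (\1_Z z)%:C) <=
    nsq (1 - p1).[cv z] * \1_E z + 6 * \1_D z + (4 / A + 8 * (q z - \1_Z z) ^+ 2).
  have := sqr_ge0 (q z - \1_Z z); rewrite !indicE.
  have [zZ|zZ] := boolP (z \in Z) => /= sq.
    have -> : (1 - p1).[cv z] - (1%:R)%:C = - p1.[cv z].
      by rewrite hornerD hornerN hornerC; apply: complex_ext;
        rewrite !ReImE /=; ring.
    rewrite nsqN (le_trans (p1E z))// -[leLHS]add0r lerD//.
      by rewrite addr_ge0 ?mulr_ge0 ?nsq_ge0.
    by rewrite -(sqrrN (1 - _)) opprB.
  have -> : (1 - p1).[cv z] - (0%:R)%:C = (1 - p1).[cv z].
    by apply: complex_ext; rewrite !ReImE /=; ring.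
  have [zE|zE] := boolP (z \in E).
    by rewrite mulr1 -addrA lerDl addr_ge0// ?mulr_ge0// addr_ge0// mulr_ge0.
  have -> : (z \in D) = true.
    by apply/mem_set => -[] /mem_set; apply/negP.
  rewrite mulr0 add0r mulr1 (@le_trans _ _ 6)//; last first.
    by rewrite lerDl addr_ge0// mulr_ge0.
  rewrite hornerD hornerN hornerC (le_trans (nsqB_le _ _))//.
  by rewrite {1}/nsq /= expr0n /= expr1n addr0 aux6.
apply: (le_lt_trans (le_bdd_Rintegral mu (bdd_mfun_nsq_indic _) _ key)).
  apply: bdd_mfunD; first by apply: bdd_mfunD => //; exact: bdd_mfunZ.
  by apply: bdd_mfunD; [exact: bdd_mfun_cst|exact: bdd_mfunZ].
rewrite bdd_RintegralD; last 2 first.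
- by apply: bdd_mfunD => //; exact: bdd_mfunZ.
- by apply: bdd_mfunD; [exact: bdd_mfun_cst|exact: bdd_mfunZ].
rewrite bdd_RintegralD//; last exact: bdd_mfunZ.
rewrite bdd_RintegralD; [|exact: bdd_mfun_cst|exact: bdd_mfunZ].
rewrite RintegralT_cst !bdd_RintegralZ// Rintegral_indic// -/Th.
have hE' : \int[mu]_z (nsq (1 - p1).[cv z] * \1_E z) <= c * (2 * (A * zeta)
  + 2 * kappa).
  apply: (le_trans (le_bdd_Rintegral_measure mE c0 hE bnp _));
    first by move=> z; exact: nsq_ge0.
  by rewrite ler_wpM2l// (le_trans mp1)// lerD2r ler_wpM2l.
apply: fin => //; exact: le_trans hE' hc.
Qed.

End analytic_approx.

(** * Closability *)

(** Final arithmetic of [dominated_closable]: [B * 0] is the contribution of the null set [Z], and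
    the denominators [c + 1] and [B + 1] allow [c] and [B] to vanish. *)
Lemma cauchy_tail_le (R : realFieldType) (e eta c B a1 a2 a3 : R) :
  0 <= c -> 0 <= B -> 0 < eta ->
  a1 < e / 4 -> a2 <= c * (eta / (4 * (c + 1))) ->
  a3 <= B * (eta / 2 / (B + 1)) -> 2 * a1 + 2 * a2 + B * 0 + a3 <= e / 2 + eta.
Proof.
move=> c0 B0 eta0.
have c1 : c * (eta / (4 * (c + 1))) <= eta / 4.
  have -> : c * (eta / (4 * (c + 1))) = eta / 4 * (c / (c + 1)).
    by field; rewrite gt_eqF//; lra.
  by rewrite ler_piMr ?divr_ge0 ?(ltW eta0)// ler_pdivrMr; lra.
have B1 : B * (eta / 2 / (B + 1)) <= eta / 2.
  have -> : B * (eta / 2 / (B + 1)) = eta / 2 * (B / (B + 1)).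
    by field; rewrite gt_eqF//; lra.
  by rewrite ler_piMr ?divr_ge0 ?(ltW eta0)// ler_pdivrMr; lra.
by lra.
Qed.

Section closability_criterion.
Variables (R : realType) (mu : {finite_measure set (circle R) -> \bar R}).
Local Notation C := R[i].
Local Notation cv := (@circle_val R).
Local Notation m := (@circle_measure R).
Hypothesis m_le : forall A, measurable A -> fine (m A) <= fine (mu A).
Variables (tf : (nat -> C) -> R) (delta : R).
Hypothesis tfE : forall p : {poly C}, \int[mu]_z nsq p.[cv z] =
  tf (fun n => p`_n) + delta * l2norm (fun n => p`_n) ^+ 2.

Lemma circle_measure_dominated : m `<< mu.
Proof.
apply/null_content_dominatesP => A mA muA0; have := m_le mA.
have -> : fine (mu A) = 0 by rewrite muA0.
move=> h; have : (m A <= 0)%E.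
  by rewrite -[m A]fineK ?fin_num_measure// lee_fin.
by move=> h'; apply/eqP; rewrite eq_le h' measure_ge0.
Qed.

Let form_normE (p : {poly C}) : form_norm (@l2norm R) tf delta (fun n => p`_n) =
  Num.sqrt (\int[mu]_z nsq p.[cv z]).
Proof. by rewrite /form_norm -tfE. Qed.

Let l2normE (p : {poly C}) : l2norm (fun n => p`_n) = Num.sqrt (\int[m]_z nsq p.[cv z]) :> R.
Proof. by rewrite -l2norm_coef sqrtr_sqr ger0_norm// sqrtr_ge0. Qed.

Let coefs_sub (p q : {poly C}) :
  (fun n => p`_n) - (fun n => q`_n) = (fun n => (p - q)`_n) :> (nat -> C).
Proof. by apply/funext => n; rewrite coefB. Qed.

Let cvg_sqrt0 (T : Type) (F : set_system T) {FF : Filter F} (u : T -> R) :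
  u x @[x --> F] --> (0 : R) -> Num.sqrt (u x) @[x --> F] --> (0 : R).
Proof.
move=> u0; have := continuous_cvg _ (@sqrt_continuous R 0) u0.
by rewrite sqrtr0; apply.
Qed.

Let cvg_sqrt0_lt (u : nat -> R) (e : R) : (forall n, 0 <= u n) -> 0 < e ->
  Num.sqrt (u x) @[x --> \oo] --> (0 : R) -> exists N, forall n, (N <= n)%N ->
    u n < e.
Proof.
move=> u0 e0 /cvgr_lt /(_ (Num.sqrt e)); rewrite sqrtr_gt0 => /(_ e0) [N _ hN].
by exists N => n Nn; have := hN n Nn; rewrite /= ltr_sqrt.
Qed.

Let Rintegral_nsq_ge0 (rho : {finite_measure set (circle R) -> \bar R}) p :
  0 <= \int[rho]_z nsq p.[cv z].
Proof. by apply: RintegralT_ge0 => z; exact: nsq_ge0. Qed.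

(** Analytic polynomials tending to the indicator of [Z] in L2 for [mu] tend to 0 in L2 for [m].
    Closability makes them tend to 0 in L2 for [mu] too, so the indicator vanishes there. *)
Lemma closable_dominated :
  closable (@l2norm R) (@finitely_supported R) tf delta -> mu `<< m.
Proof.
move=> cl; have [Z [mZ Z0 Zsplit]] := density_split circle_measure_dominated.
(* An m-null set is covered by [Z], by its trace on [E], where [mu <= c m], and by a remainder of
   [mu]-measure below [e]. *)
suff muZ : fine (mu Z) = 0.
  apply/null_content_dominatesP => A mA mA0.
  have : fine (mu A) <= 0.
    apply/ler_addgt0Pr => e e0; rewrite add0r.
    have [E [c [mE EZ c0 hD hE]]] := Zsplit e e0.
    have mAE : measurable (A `&` E) by exact: measurableI.
    have mD : measurable (~` (Z `|` E)) by apply: measurableC; exact: measurableU.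
    have mZAE : measurable (Z `|` (A `&` E)) by exact: measurableU.
    have AE0 : fine (mu (A `&` E)) <= 0.
      have hAE := hE _ mAE (@subIsetr _ _ _).
      have mAE0 : m (A `&` E) = 0%E.
        by apply/eqP; rewrite eq_le measure_ge0 andbT -mA0 le_measure ?inE.
      have z0 : fine (m (A `&` E)) = 0 by rewrite mAE0.
      by move: hAE; rewrite z0 mulr0.
    have sub : (mu A <= mu Z + mu (A `&` E) + mu (~` (Z `|` E)))%E.
      apply: (@le_trans _ _ (mu (Z `|` (A `&` E) `|` ~` (Z `|` E)))).
        apply: le_measure; rewrite ?inE//; first exact: measurableU.
        move=> x Ax; have [zx|nzx] := pselect ((Z `|` E) x); last by right.
        case: zx => zx; first by left; left.
        by left; right.
      rewrite (le_trans (measureU2 _ _ _))//.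
      by rewrite leeD2r// measureU2.
    have := fine_le _ _ sub.
    rewrite !fineD ?fin_numD ?fin_num_measure// => /(_ isT isT); rewrite muZ add0r.
    by move=> /le_trans; apply; rewrite -[leRHS]add0r lerD// ltW.
  move=> h; apply/eqP; rewrite eq_le measure_ge0 andbT -[mu A]fineK ?fin_num_measure//.
have b z := bdd_mfun_nsq_indic mZ.
have approx (k : nat) : exists p : {poly C},
    \int[mu]_z nsq (p.[cv z] - (\1_Z z)%:C) < k.+1%:R^-1.
  by apply: (indic_approx_analytic m_le mZ Z0 Zsplit); rewrite invr_gt0.
have [p_ hp] := choice approx.
have harm : (k.+1%:R^-1 : R) @[k --> \oo] --> (0 : R) by exact: cvg_harmonic.
have lt2 (k l : nat) : \int[mu]_z nsq (p_ k - p_ l).[cv z] <=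
    2 * k.+1%:R^-1 + 2 * l.+1%:R^-1.
  apply: (@le_trans _ _ (\int[mu]_z (2 * nsq ((p_ k).[cv z] - (\1_Z z)%:C) +
                                     2 * nsq ((p_ l).[cv z] - (\1_Z z)%:C)))).
    apply: le_bdd_Rintegral; first exact: bdd_mfun_nsq.
      by apply: bdd_mfunD; apply: bdd_mfunZ; exact: bdd_mfun_nsq_indic.
    move=> z; apply: le_trans (nsqB_le _ _).
    by rewrite le_eqVlt; apply/orP; left; apply/eqP; congr nsq;
      rewrite hornerD hornerN; ring.
  rewrite bdd_RintegralD; [|by apply: bdd_mfunZ;
    exact: bdd_mfun_nsq_indic|by apply: bdd_mfunZ; exact: bdd_mfun_nsq_indic].
  by rewrite !bdd_RintegralZ; [apply: lerD;
    rewrite ler_pM2l ?ltW|exact: bdd_mfun_nsq_indic|exact: bdd_mfun_nsq_indic].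
have hlim : form_norm (@l2norm R) tf delta (fun n => (p_ k)`_n) @[k --> \oo] --> (0 : R).
  apply: (cl (fun k n => (p_ k)`_n)).
  - by move=> k; apply/finitely_supportedP; exists (p_ k).
  - under eq_fun do rewrite l2normE.
    apply: cvg_sqrt0.
    apply: (squeeze_cvgr _ (cvg_cst (0 : R)) harm); apply: nearW => k.
    rewrite Rintegral_nsq_ge0 /= (le_trans _ (ltW (hp k)))//.
    apply: (le_Rintegral_off_null m_le mZ Z0).
    + exact: bdd_mfun_nsq.
    + exact: bdd_mfun_nsq_indic.
    + by move=> z; exact: nsq_ge0.
    + by move=> z; exact: nsq_ge0.
    + by move=> z nZ; rewrite indicE memNset//= (_ : 0%:C = 0)// subr0.
  - under eq_fun do rewrite coefs_sub form_normE.
    apply: cvg_sqrt0.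
    have c2 : 2 * (kl.1.+1%:R^-1 : R) + 2 * (kl.2.+1%:R^-1)
        @[kl --> filter_prod \oo \oo] --> (0 : R).
      rewrite [X in _ --> X](_ : _ = 2 * 0 + 2 * 0 :> R);
        last by rewrite mulr0 addr0.
      apply: cvgD; apply: cvgMr.
        exact: (cvg_comp _ _ cvg_fst harm).
      exact: (cvg_comp _ _ cvg_snd harm).
    apply: (squeeze_cvgr _ (cvg_cst (0 : R)) c2); apply: nearW => kl.
    by rewrite Rintegral_nsq_ge0 lt2.
move: hlim; under eq_fun do rewrite form_normE; move=> hlim.
apply/eqP; rewrite eq_le fine_ge0// andbT; apply/ler_addgt0Pr => e e0.
rewrite add0r; have e4 : 0 < e / 4 by rewrite divr_gt0.
have [N1 hN1] := cvg_sqrt0_lt (fun k => Rintegral_nsq_ge0 mu (p_ k)) e4 hlim.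
have [N2 _ hN2] := (cvgr_lt _ harm) _ e4.
pose N := maxn N1 N2.
have h1 := hN1 N (leq_maxl _ _);
  have h2 : N.+1%:R^-1 < e / 4 := hN2 N (leq_maxr _ _).
rewrite -Rintegral_indic//.
(* The indicator is [p - (p - 1_Z)], and both squared norms are below [e / 4]. *)
apply: (@le_trans _ _ (\int[mu]_z (2 * nsq (p_ N).[cv z] +
                                   2 * nsq ((p_ N).[cv z] - (\1_Z z)%:C)))).
  apply: le_bdd_Rintegral; first exact: bdd_mfun_indic.
    by apply: bdd_mfunD; apply: bdd_mfunZ;
      [exact: bdd_mfun_nsq|exact: bdd_mfun_nsq_indic].
  move=> z; apply: le_trans (nsqB_le _ _).
  have -> : (p_ N).[cv z] - ((p_ N).[cv z] - (\1_Z z)%:C) = (\1_Z z)%:C by ring.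
  rewrite /nsq /= indicE; case: (z \in Z); rewrite /= ?expr0n ?expr1n /= ?addr0//.
rewrite bdd_RintegralD; [|by apply: bdd_mfunZ;
  exact: bdd_mfun_nsq|by apply: bdd_mfunZ; exact: bdd_mfun_nsq_indic].
rewrite !bdd_RintegralZ; [|exact: bdd_mfun_nsq_indic|exact: bdd_mfun_nsq].
have := lt_trans (hp N) h2; move: h1.
set x := Rintegral _ _ _; set y := Rintegral _ _ _.
by move=> *; lra.
Qed.

(** For fixed [k], [p_k] is compared on [E] with a late [p_l], which is small there since
    [mu <= c m]. Outside [E] the crude bound of [|p_k|^2] suffices, because [Z] is now [mu]-null and
    [D] has small measure. *)
Lemma dominated_closable : mu `<< m ->
  closable (@l2norm R) (@finitely_supported R) tf delta.
Proof.
move=> mum; have [Z [mZ Z0 Zsplit]] := density_split circle_measure_dominated.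
have muZ : mu Z = 0%E by move/null_content_dominatesP : mum; apply.
move=> g gfin gto0 gcauchy.
have [p_ gE] : exists p_ : nat -> {poly C}, g = (fun k => (fun n => (p_ k)`_n)).
  have [p_ hp] := choice (fun k => (finitely_supportedP (g k)).1 (gfin k)).
  by exists p_; apply/funext => k; rewrite hp.
subst g.
under eq_fun do rewrite form_normE.
move: gto0; under eq_fun do rewrite l2normE; move=> gto0.
move: gcauchy; under eq_fun do rewrite coefs_sub form_normE; move=> gcauchy.
apply: cvg_sqrt0; apply/cvgrPdist_le => e e0.
have e4 : 0 < e / 4 by rewrite divr_gt0.
have [N hN] : exists N, forall k l, (N <= k)%N -> (N <= l)%N ->
    \int[mu]_z nsq (p_ k - p_ l).[cv z] < e / 4.
  have [[P Q] [/= [N1 _ P1] [N2 _ Q2]] PQ] :=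
    (cvgr_lt _ gcauchy) (Num.sqrt (e / 4)) ltac:(by rewrite sqrtr_gt0).
  exists (maxn N1 N2) => k l; rewrite !geq_max => /andP[k1 _] /andP[_ l2].
  have := PQ (k, l) (conj (P1 k k1) (Q2 l l2)).
  by rewrite /= ltr_sqrt.
exists N => // k /= Nk; rewrite sub0r normrN ger0_norm ?Rintegral_nsq_ge0//.
suff : \int[mu]_z nsq (p_ k).[cv z] <= e / 2 by lra.
have bk := bdd_mfun_nsq (p_ k); have [_ [B hB]] := bk.
have B0 : 0 <= B by exact: le_trans (normr_ge0 _) (hB (expi 0)).
(* A second tolerance is needed: the bound [B] depends on [k], so [E], [c] and [l] are chosen after
   [k] while the Cauchy index [N] depends on [e] only. *)
apply/ler_addgt0Pr => eta eta0.
have eta2 : 0 < eta / 2 / (B + 1) by rewrite !divr_gt0// ltr_wpDl.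
have [E [c [mE EZ c0 hD hE]]] := Zsplit _ eta2.
set D := ~` (Z `|` E) in hD.
have mD : measurable D by apply: measurableC; exact: measurableU.
have bE := bdd_mfun_indic R mE; have bD := bdd_mfun_indic R mD;
  have bZ := bdd_mfun_indic R mZ.
have eta4 : 0 < eta / (4 * (c + 1)) by rewrite divr_gt0// mulr_gt0// ltr_wpDl.
have [N' hN'] := cvg_sqrt0_lt (fun l => Rintegral_nsq_ge0 m (p_ l)) eta4 gto0.
pose l := maxn N N'.
have hl := hN' l (leq_maxr _ _).
have hkl := hN k l Nk (leq_maxl _ _).
have bl := bdd_mfun_nsq (p_ l); have bkl := bdd_mfun_nsq (p_ k - p_ l).
have key z : nsq (p_ k).[cv z] <= 2 * nsq (p_ k - p_ l).[cv z] +
    2 * (nsq (p_ l).[cv z] * \1_E z) + B * \1_Z z + B * \1_D z.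
  have n1 : 0 <= nsq (p_ k - p_ l).[cv z] by exact: nsq_ge0.
  have n2 : 0 <= nsq (p_ l).[cv z] by exact: nsq_ge0.
  have n3 : nsq (p_ k).[cv z] <= B by exact: le_trans (ler_norm _) (hB z).
  rewrite !indicE; have [zZ|zZ] := boolP (z \in Z).
    rewrite mulr1 (le_trans n3)// -addrA -[leLHS]add0r lerD//.
      by rewrite addr_ge0// mulr_ge0// mulr_ge0.
    by rewrite lerDl mulr_ge0.
  have [zE|zE] := boolP (z \in E).
    rewrite mulr1 mulr0 addr0 (@le_trans _ _ (2 * nsq (p_ k - p_ l).[cv z]
      + 2 * nsq (p_ l).[cv z]))//.
      rewrite [X in nsq X <= _](_ : _ = (p_ k - p_ l).[cv z] + (p_ l).[cv z]);
        last first.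
        by rewrite hornerD hornerN subrK.
      exact: nsqD_le.
    by rewrite lerDl mulr_ge0.
  have -> : (z \in D) = true by apply/mem_set => -[] /mem_set; apply/negP.
  by rewrite !mulr0 !addr0 mulr1 (le_trans n3)// lerDr mulr_ge0.
have hI : \int[mu]_z (nsq (p_ l).[cv z] * \1_E z) <= c * (eta / (4 * (c + 1))).
  apply: (le_trans (le_bdd_Rintegral_measure mE c0 hE bl _));
    first by move=> z; exact: nsq_ge0.
  by rewrite ler_wpM2l// ltW.
have bEl : bdd_mfun (fun z => nsq (p_ l).[cv z] * \1_E z) by exact: bdd_mfunM.
have b1 := bdd_mfunZ 2 bkl; have b2 := bdd_mfunZ 2 bEl.
have b3 := bdd_mfunZ B bZ; have b4 := bdd_mfunZ B bD.
apply: (le_trans (le_bdd_Rintegral mu bk (bdd_mfunD (bdd_mfunD (bdd_mfunD b1 b2) b3) b4) key)).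
rewrite (bdd_RintegralD _ (bdd_mfunD (bdd_mfunD b1 b2) b3) b4) (bdd_RintegralD _ (bdd_mfunD b1 b2) b3) (bdd_RintegralD _ b1 b2).
rewrite (bdd_RintegralZ _ _ bkl) (bdd_RintegralZ _ _ bEl) (bdd_RintegralZ _ _ bZ) (bdd_RintegralZ _ _ bD) !Rintegral_indic// muZ.
by apply: (cauchy_tail_le c0 B0 eta0 hkl hI); rewrite ler_wpM2l// ltW.
Qed.

End closability_criterion.

(** The two set functions agree on m-null sets, where the shift by [delta m] vanishes. *)
Lemma dominated_form_measure (R : realType) (delta : R)
    (M : {charge set (circle R) -> \bar R})
    (mu : {finite_measure set (circle R) -> \bar R}) :
  (forall A, measurable A ->
    fine (mu A) = fine (M A) + delta * fine (circle_measure A)) ->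
  mu `<< circle_measure (R := R) <-> M `<< circle_measure (R := R).
Proof.
move=> muE; split=> /null_content_dominatesP dom;
  apply/null_content_dominatesP => A mA mA0; have := muE A mA;
  rewrite mA0 mulr0 addr0 (dom A mA mA0) => E.
  by rewrite -[LHS]fineK ?fin_num_measure// -E.
by rewrite -[LHS]fineK ?fin_num_measure// E.
Qed.

Theorem theorem1p3 (R : realType) (t : int -> R[i]) (gamma : R)
    (t_hermitian : forall n : int, t n = (t (- n))^*)
    (t_semibounded : forall g : nat -> R[i], finitely_supported g ->
      (gamma * l2norm g ^+ 2)%:C <= toeplitz_form t g)
    (M : {charge set (circle R) -> \bar R})
    (M_moments : forall n : int,
      t n = charge_Cintegral M (fun z : circle R => circle_val z ^ (- n)))
    (delta : R) (gamma_delta : 1 <= gamma + delta) :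
  closable (@l2norm R) (@finitely_supported R)
    (fun g => complex.Re (toeplitz_form t g)) delta
  <-> M `<< circle_measure (R := R).
Proof.
have [mu [muE m_le muform]] := form_measure t_semibounded M_moments gamma_delta.
rewrite -(dominated_form_measure muE); split.
  exact: (closable_dominated m_le muform).
exact: (dominated_closable m_le muform).
Qed.
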